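(* Let $n\ge 1$ and let $\mathbf r=(r_1,\dots,r_n)$ satisfy $r_i>0$ for all $i$ and $\sum_{i=1}^n r_i=1$. Let $\mathcal F^{(\mathbf r)}=\{\Phi^{(\mathbf r)}_t : t>0\}$ be the one-parameter semigroup of linear contractions of $\mathbb R^n$ given by $\Phi^{(\mathbf r)}_t=\mathrm{diag}\big(e^{-(1+r_1)t},\dots,e^{-(1+r_n)t}\big)$. Then the set $\mathbf{Bad}(\mathbf r)$ of $\mathbf r$-badly approximable vectors is a winning set for the modified Schmidt game induced by $\mathcal F^{(\mathbf r)}$ (for any choice of initial admissible domain $D_0$). In particular, $\mathbf{Bad}(\mathbf r)$ is thick.
   Context: A vector $\mathbf x\in\mathbb R^n$ is $\mathbf r$-badly approximable if there is $c>0$ such that $\max_{1\le i\le n}|qx_i-p_i|^{1/r_i}\ge c/q$ for all $\mathbf p=(p_1,\dots,p_n)\in\mathbb Z^n$ and $q\in\mathbb N$ (positive integers); $\mathbf{Bad}(\mathbf r)$ is the set of all such vectors. A subset of $\mathbb R^n$ is thick if its intersection with every nonempty open subset of $\mathbb R^n$ has Hausdorff dimension $n$. Modified Schmidt game induced by $\mathcal F=\{\Phi_t:t>0\}$, where $\Phi_t$ is a one-parameter group of linear automorphisms of $\mathbb R^n$ contracting for $t>0$ (here $\Phi_t=\Phi_t^{(\mathbf r)}$, defined by the same formula for all $t\in\mathbb R$). Let $D_0\subset\mathbb R^n$ be admissible, i.e. compact with nonempty interior. For $(x,t)\in\Omega=\mathbb R^n\times\mathbb R$ put $\psi(x,t)=\Phi_t(D_0)+x$,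 and write $(x',t')\le(x,t)$ iff $\psi(x',t')\subset\psi(x,t)$. Fix $a_*\ge0$ such that for every $s> a_*$ and every $(x,t)\in\Omega$ there is $x'$ with $(x',t+s)\le(x,t)$ (such $a_*$ exists). For $a,b>a_*$, the $(a,b)$-game is played by Alice and Bob: Bob picks $\omega_1=(x_1,t_1)\in\Omega$; then for $k=1,2,\dots$, given $\omega_k=(x_k,t_k)$, Alice picks $x_k'$ with $\omega_k'=(x_k',t_k+a)\le\omega_k$, and Bob picks $x_{k+1}$ with $\omega_{k+1}=(x_{k+1},t_k+a+b)\le\omega_k'$, where $t_{k+1}=t_k+a+b$. A set $S$ is $(a,b)$-winning if Alice has a strategy guaranteeing $\bigcap_k\psi(\omega_k)\subset S$ however Bob plays; it is $a$-winning if it is $(a,b)$-winning for all $b>a_*$; it is winning if it is $a$-winning for some $a>a_*$. *)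

(* Defs.v *)
From HB Require Import structures.
From mathcomp Require Import all_boot all_order all_algebra.
From mathcomp Require Import all_classical all_reals all_analysis.

Set Implicit Arguments.
Unset Strict Implicit.
Unset Printing Implicit Defensive.

Import Order.TTheory GRing.Theory Num.Theory.
Import numFieldNormedType.Exports.

Local Open Scope classical_set_scope.
Local Open Scope ring_scope.

(* On ['rV[R]_n] the library norm is the sup norm; as all norms on R^n are
   equivalent, the dimension is the one given by the Euclidean distance. *)
Definition diameter (R : realType) (V : normedModType R) (A : set V) : \bar R :=
  ereal_sup [set `|z.1 - z.2|%:E | z in A `*` A].

(* [diameter set0 = -oo]: the empty set is made to contribute 0 to the sums
   below.  A nonempty set of diameter 0 contributes 1 when [s = 0]. *)
Definition hausdorff_gauge (R : realType) (V : normedModType R) (s : R)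
    (A : set V) : \bar R :=
  if A == set0 then 0%E else poweR (diameter A) s.

Definition hausdorff_premeasure (R : realType) (V : normedModType R)
    (s delta : R) (A : set V) : \bar R :=
  ereal_inf [set (\sum_(0 <= i <oo) hausdorff_gauge s (U i))%E | U in
    [set U : (set V)^nat | A `<=` \bigcup_i U i /\
                           forall i, (diameter (U i) <= delta%:E)%E]].

(* The supremum is the limit as [delta] tends to 0. *)
Definition hausdorff_measure (R : realType) (V : normedModType R) (s : R)
    (A : set V) : \bar R :=
  ereal_sup [set hausdorff_premeasure s delta A | delta in [set d : R | 0 < d]].

Definition hausdorff_dim (R : realType) (V : normedModType R) (A : set V) :
    \bar R :=
  ereal_inf [set s%:E | s in [set s : R | 0 <= s /\ hausdorff_measure s A = 0%E]].

Definition thick (R : realType) (n : nat) (S : set 'rV[R]_n) : Prop :=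
  forall U : set 'rV[R]_n, open U -> U !=set0 ->
    hausdorff_dim (S `&` U) = n%:R%:E.

(* The base value 0 of the maximum is harmless: the terms are nonnegative. *)
Definition Bad (R : realType) (n : nat) (r : 'rV[R]_n) : set 'rV[R]_n :=
  [set x | exists2 c : R, 0 < c &
    forall (p : 'rV[int]_n) (q : nat), (0 < q)%N ->
      \big[Num.max/0]_(i < n)
         (`|q%:R * x ord0 i - (p ord0 i)%:~R| `^ (1 / r ord0 i)) >= c / q%:R].

Definition Phi (R : realType) (n : nat) (r : 'rV[R]_n) (t : R)
    (x : 'rV[R]_n) : 'rV[R]_n :=
  x *m diag_mx (\row_i expR (- (1 + r ord0 i) * t)).

Definition admissible (R : realType) (n : nat) (D0 : set 'rV[R]_n) : Prop :=
  compact D0 /\ interior D0 !=set0.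

Definition position (R : realType) (n : nat) : Type := ('rV[R]_n * R)%type.

Definition psi (R : realType) (n : nat) (F : R -> 'rV[R]_n -> 'rV[R]_n)
    (D0 : set 'rV[R]_n) (w : position R n) : set 'rV[R]_n :=
  [set F w.2 y + w.1 | y in D0].

Definition pos_le (R : realType) (n : nat) (F : R -> 'rV[R]_n -> 'rV[R]_n)
    (D0 : set 'rV[R]_n) (w' w : position R n) : Prop :=
  psi F D0 w' `<=` psi F D0 w.

Definition is_astar (R : realType) (n : nat) (F : R -> 'rV[R]_n -> 'rV[R]_n)
    (D0 : set 'rV[R]_n) (astar : R) : Prop :=
  0 <= astar /\
  forall s : R, astar < s -> forall (x : 'rV[R]_n) (t : R),
    exists x' : 'rV[R]_n, pos_le F D0 (x', t + s) (x, t).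

(* A strategy of Alice sends the list of Bob's moves up to and including
   round [k] to the centre of her move in round [k]; her own previous moves are
   determined by it. *)
Definition strategy (R : realType) (n : nat) : Type :=
  seq (position R n) -> 'rV[R]_n.

(* [w k] is Bob's move in round [k], the rounds being numbered from 0. *)
Definition alice_move (R : realType) (n : nat) (a : R) (sigma : strategy R n)
    (w : nat -> position R n) (k : nat) : position R n :=
  (sigma (mkseq w k.+1), (w k).2 + a).

Definition alice_legal (R : realType) (n : nat)
    (F : R -> 'rV[R]_n -> 'rV[R]_n) (D0 : set 'rV[R]_n) (a : R)
    (sigma : strategy R n) (w : nat -> position R n) (k : nat) : Prop :=
  pos_le F D0 (alice_move a sigma w k) (w k).

(* Legality of Bob's move in round [k.+1]; his first move is free. *)
Definition bob_legal (R : realType) (n : nat)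
    (F : R -> 'rV[R]_n -> 'rV[R]_n) (D0 : set 'rV[R]_n) (a b : R)
    (sigma : strategy R n) (w : nat -> position R n) (k : nat) : Prop :=
  (w k.+1).2 = (w k).2 + a + b /\
  pos_le F D0 (w k.+1) (alice_move a sigma w k).

(* The strategy must answer legally as long as Bob has played legally. *)
Definition ab_winning (R : realType) (n : nat)
    (F : R -> 'rV[R]_n -> 'rV[R]_n) (D0 : set 'rV[R]_n) (a b : R)
    (S : set 'rV[R]_n) : Prop :=
  exists sigma : strategy R n, forall w : nat -> position R n,
    (forall k : nat,
       (forall j : nat, (j < k)%N -> bob_legal F D0 a b sigma w j) ->
       alice_legal F D0 a sigma w k) /\
    ((forall k : nat, bob_legal F D0 a b sigma w k) ->
       \bigcap_k psi F D0 (w k) `<=` S).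

Definition a_winning (R : realType) (n : nat)
    (F : R -> 'rV[R]_n -> 'rV[R]_n) (D0 : set 'rV[R]_n) (astar a : R)
    (S : set 'rV[R]_n) : Prop :=
  forall b : R, astar < b -> ab_winning F D0 a b S.

Definition winning (R : realType) (n : nat)
    (F : R -> 'rV[R]_n -> 'rV[R]_n) (D0 : set 'rV[R]_n) (astar : R)
    (S : set 'rV[R]_n) : Prop :=
  exists2 a : R, astar < a & a_winning F D0 astar a S.

(* Main.v *)
Require Import Defs.
From HB Require Import structures.
From mathcomp Require Import all_boot all_order all_algebra.
From mathcomp Require Import all_classical all_reals all_analysis.
From mathcomp Require Import perm ring lra.

Import Order.TTheory GRing.Theory Num.Theory.
Import numFieldNormedType.Exports.
Local Open Scope classical_set_scope.
Local Open Scope ring_scope.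

Set Implicit Arguments.
Unset Strict Implicit.
Unset Printing Implicit Defensive.

(** Bad(r) is winning because the rational points of small denominator in a
    small box lie on one hyperplane, and Alice can dodge a hyperplane.  A box
    at time [t] has sides proportional to [expR (- (1 + r_i) t)]; as the
    numbers [1 + r_i] add up to [n + 1], its volume is of order
    [expR (- (n + 1) t)].  On the other hand [n + 1] affinely independent
    rational points with denominators [q_0, ..., q_n] span a simplex of volume
    at least [1 / (n! q_0 ... q_n)].  If all [q_j] are below [kappa expR t]
    with [kappa] small, both cannot hold, so the rational points in question
    are not affinely independent ([det_rat_disp_eq0], [simplex_hyperplane]).
    Alice then moves to a box that avoids the hyperplane by a fixed proportion
    of the size of Bob's box ([exists_off_hyperplane]); the value of [a] that
    makes room for this does not depend on [b].  The
    times of the game increase by [a + b], so each denominator [q] is dodged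
    at a stage where [expR t] is at most a constant times [q]; rescaled, the
    distance gained at this stage is the inequality that defines Bad(r)
    ([Bad_of_away]).

    Thickness holds for every set [S] that is winning when the domain is the
    cube [-1, 1]^n ([winning_thick]).  Bob fills each of Alice's boxes with a
    grid of [N] boxes of the next stage, with [N] of order
    [expR (b (n + 1))], which covers a fixed proportion of Alice's box.
    Letting Bob choose grid boxes at random gives a measure on [S], and the
    loss per stage is a factor [K] independent of [b]: a set of diameter
    [expR (- u)] has measure at most a constant times
    [expR (- u n) K ^ (u / b)], which for large [b] is at most a
    constant times [expR (- u s)], for any given [s < n]
    ([density_volume], [density_root_le]).  A cover of [S] in the given open
    set with a small sum of [s]-th powers of diameters would thus have total
    measure less than 1.  No limit measure is built: choosing at each stage a
    grid box in which the remaining measure of the cover is below 1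
    produces a play whose outcome lies in [S] but in no set of the cover
    ([greedy_branch], [winning_hausdorff_measure_neq0]).  So the dimension
    is at least [n]; it is at most [n] because a bounded part of R^n is
    covered by [c / e ^ n] cubes of side [e]
    ([hausdorff_measure_gt_dim]). *)

(** * Determinants and hyperplanes *)

Lemma norm_det_le (R : realType) (n : nat) (A : 'M[R]_n) (M : R) :
  (forall i j, `|A i j| <= M) -> `|\det A| <= n`!%:R * M ^+ n.
Proof.
move=> hA.
rewrite /determinant (le_trans (ler_norm_sum _ _ _))//.
have -> : n`!%:R * M ^+ n = \sum_(s : {perm 'I_n}) M ^+ n.
  by rewrite sumr_const card_Sn mulr_natl.
apply: ler_sum => s _; rewrite normrM normrX normrN1 expr1n mul1r normr_prod.
rewrite -[X in M ^+ X](card_ord n) -prodr_const.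
by apply: ler_prod => i _; rewrite normr_ge0 hA.
Qed.

(** A matrix of maximal rank with rows in [S] has every element of [S] in its
    row space, by maximality.  Its rank is below [d], since otherwise [d] of its
    rows would form an invertible matrix; a nonzero column of its cokernel is
    then orthogonal to [S]. *)
Lemma orthogonal_of_det0 (F : fieldType) (d : nat) (S : set 'rV[F]_d) :
  (forall A : 'M[F]_d, (forall i, S (row i A)) -> \det A = 0) ->
  exists2 u : 'cV[F]_d, u != 0 & forall v, S v -> v *m u = 0.
Proof.
move=> hS.
pose P (k : nat) := exists m (A : 'M[F]_(m, d)),
  (forall i, S (row i A)) /\ \rank A = k.
have P0 : exists k, `[<P k>].
  exists 0; apply/asboolP; exists 0%N, 0; split; first by case.
  by rewrite mxrank0.
have Pd k : `[<P k>] -> (k <= d)%N.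
  by move=> /asboolP[m [A [_ <-]]]; exact: rank_leq_col.
case: (ex_maxnP P0 Pd) => k /asboolP[m [A [rowA rkA]]] kmax.
have SA v : S v -> (v <= A)%MS.
  move=> Sv.
  have rk : (\rank (col_mx A v) <= k)%N.
    apply: kmax; apply/asboolP; exists (m + 1)%N, (col_mx A v); split => // i.
    have [j ->|j ->] := split_ordP i; first by rewrite rowKu; exact: rowA.
    rewrite rowKd; suff -> : row j v = v by [].
    by apply/rowP => l; rewrite mxE ord1.
  have := mxrank_leqif_eq (addsmxSl A v).
  rewrite (addsmxE A v) rkA => -[kle keq].
  have : (k == \rank (col_mx A v)) by rewrite eqn_leq kle rk.
  by rewrite keq => e; rewrite (eqmxP e) addsmxSr.
have kd : (k < d)%N.
  rewrite ltn_neqAle Pd ?andbT; last by apply/asboolP; exists m, A.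
  apply/negP => /eqP kd.
  have fA : row_full A by rewrite /row_full rkA kd.
  have := fullrowsub_unit fA; rewrite unitmxE hS ?unitr0// => i.
  by rewrite row_rowsub.
have : cokermx A != 0 by rewrite -mxrank_eq0 mxrank_coker rkA subn_eq0 -ltnNge.
move=> /matrix0Pn[i [j uij]].
exists (col j (cokermx A)).
  by apply/matrix0Pn; exists i, 0; rewrite mxE.
move=> v /SA /submxP[w ->].
by rewrite -mulmxA colE (mulmxA A) mulmx_coker mul0mx mulmx0.
Qed.

(** * The simplex lemma *)

(** The factor by which the inverse of [Phi r t] stretches the [i]-th axis. *)
Definition dilation (R : realType) (n : nat) (r : 'rV[R]_n) (t : R)
    (i : 'I_n) : R :=
  expR ((1 + r ord0 i) * t).

(** The rational point [p / q] in coordinates that turn a box of the game at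
    time [t] centred at [x] into a box of fixed shape centred at 0. *)
Definition rat_disp (R : realType) (n : nat) (r x : 'rV[R]_n) (t : R)
    (p : 'rV[int]_n) (q : nat) (i : 'I_n) : R :=
  ((p ord0 i)%:~R / q%:R - x ord0 i) * dilation r t i.

Lemma dilation_gt0 (R : realType) (n : nat) (r : 'rV[R]_n) (t : R) (i : 'I_n) :
  0 < dilation r t i.
Proof. exact: expR_gt0. Qed.

Lemma prod_dilation (R : realType) (n : nat) (r : 'rV[R]_n) (t : R) :
  \sum_(i < n) r ord0 i = 1 -> \prod_i dilation r t i = expR t ^+ n.+1.
Proof.
move=> hsum; rewrite -expR_sum -mulr_suml big_split /= hsum sumr_const card_ord.
by rewrite -expRM_natl -[in RHS]natr1.
Qed.

(** Up to the unimodular translation by [x], the matrix [A] is obtained from the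
    integer matrix with rows [(q_j, p_j)] by dividing the rows by [q_j]
    and multiplying the columns by the dilation factors, whose product is
    [expR t ^+ n.+1].  The bound on the [q_j] makes the integer determinant
    smaller than 1 in absolute value, hence 0. *)
Lemma det_rat_disp_eq0 (R : realType) (n : nat) (r x : 'rV[R]_n) (t M : R)
    (p : 'I_(1 + n) -> 'rV[int]_n) (q : 'I_(1 + n) -> nat)
    (A : 'M[R]_(1 + n)) :
  \sum_(i < n) r ord0 i = 1 -> 1 <= M ->
  (forall j, (0 < q j)%N) ->
  (forall j, (q j)%:R < ((1 + n)`!%:R * M)^-1 * expR t) ->
  (forall j i, `|rat_disp r x t (p j) (q j) i| <= M) ->
  (forall j, row j A = row_mx 1 (\row_i rat_disp r x t (p j) (q j) i)) ->
  \det A = 0.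
Proof.
move=> hsum M1 q0 qle hM hA.
have M0 : 0 < M by apply: lt_le_trans M1.
have f0 : 0 < ((1 + n)`!)%:R :> R by rewrite ltr0n fact_gt0.
pose B : 'M[int]_(1 + n) :=
  row_mx (\col_j (q j)%:Z) (\matrix_(j, i) p j ord0 i).
pose G : 'M[R]_(1 + n) :=
  block_mx 1 x 0 (diag_mx (\row_i (dilation r t i)^-1)).
have A0 j l : A j l = row_mx 1 (\row_i rat_disp r x t (p j) (q j) i) 0 l.
  by rewrite -hA mxE.
have BE : map_mx intr B = diag_mx (\row_j (q j)%:R) *m A *m G.
  apply/row_matrixP => j.
  rewrite !row_mul row_diag_mx -scalemxAl -rowE hA mxE -scalemxAl mul_row_block.
  rewrite mul1mx mulmx0 addr0 mul1mx.
  apply/rowP => l; rewrite [LHS]mxE [LHS]mxE [RHS]mxE /B.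
  case: (split_ordP l) => k ->.
    by rewrite !row_mxEl !mxE ord1 mulr1 pmulrn.
  rewrite !row_mxEr !mxE /=.
  rewrite (bigD1 k)//= big1 ?addr0 => [|l' ne]; last first.
    by rewrite !mxE (negbTE ne) mulr0n mulr0.
  rewrite !mxE eqxx mulr1n /rat_disp.
  have := dilation_gt0 r t k; set D := dilation _ _ _ => D0.
  have qj0 : (q j)%:R != 0 :> R by rewrite pnatr_eq0 -lt0n.
  have D0' : D != 0 by rewrite gt_eqF.
  by field; rewrite qj0 D0'.
have detE : (\det B)%:~R = (\prod_j (q j)%:R) * \det A / expR t ^+ n.+1.
  rewrite -det_map_mx BE !det_mulmx det_diag /G det_ublock det1 mul1r det_diag.
  rewrite -(prod_dilation t hsum) -prodfV.
  by congr (_ * _ * _); apply: eq_bigr => j _; rewrite mxE.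
have Q0 : 0 < \prod_j ((q j)%:R : R).
  by apply: prodr_gt0 => j _; rewrite ltr0n.
have dA : `|\det A| <= (1 + n)`!%:R * M ^+ (1 + n).
  apply: norm_det_le => j l; rewrite A0.
  case: (split_ordP l) => k ->; rewrite ?row_mxEl ?row_mxEr mxE//.
  by rewrite ord1 normr1.
have dB : `|(\det B)%:~R : R| < 1.
  rewrite detE normrM normrM (gtr0_norm Q0) [X in _ * X]gtr0_norm
    ?invr_gt0 ?exprn_gt0 ?expR_gt0//.
  rewrite ltr_pdivrMr ?exprn_gt0 ?expR_gt0// mul1r.
  have qQ : \prod_j ((q j)%:R : R) < (((1 + n)`!%:R * M)^-1 * expR t) ^+ (1 + n).
    rewrite -[X in _ < _ ^+ X](card_ord (1 + n)) -prodr_const.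
    apply: ltr_prod => [|j _]; last by rewrite ler0n qle.
    by apply/hasP; exists ord0; rewrite ?mem_index_enum.
  have fM : 0 < (1 + n)`!%:R * M ^+ (1 + n) by rewrite mulr_gt0// exprn_gt0.
  apply: (@le_lt_trans _ _ ((\prod_j (q j)%:R) * ((1 + n)`!%:R * M ^+ (1 + n)))).
    by rewrite ler_pM2l.
  apply: (@lt_le_trans _ _ ((((1 + n)`!%:R * M)^-1 * expR t) ^+ (1 + n)
            * ((1 + n)`!%:R * M ^+ (1 + n)))).
    by rewrite ltr_pM2r.
  set f := (1 + n)`!%:R in f0 *.
  have -> : ((f * M)^-1 * expR t) ^+ (1 + n) * (f * M ^+ (1 + n)) =
            expR t ^+ n.+1 * (f^-1) ^+ n.
    rewrite add1n invfM !exprMn !exprVn !exprS.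
    by field; rewrite ?expf_neq0 ?gt_eqF.
  rewrite ger_pMr ?exprn_gt0 ?expR_gt0// exprn_ile1 ?invr_ge0 ?(ltW f0)//.
  by rewrite invf_le1// ler1n fact_gt0.
have B0 : \det B = 0.
  apply/eqP; apply: contraTT dB => B0; rewrite -leNgt -intr_norm.
  by rewrite ler1z -gtz0_ge1 normr_gt0.
move: detE; rewrite B0 mulr0z => /esym/eqP; rewrite !mulf_eq0 (gt_eqF Q0)/=.
by rewrite invr_eq0 expf_eq0 (gt_eqF (expR_gt0 t)) andbF orbF => /eqP.
Qed.

(** The vectors [(1, w)], with [w] a rescaled rational point, are orthogonal to
    a common nonzero vector [(-d, L)].  Here [L] is nonzero as soon as
    there is one such point, so it can be divided by its largest entry. *)
Lemma simplex_hyperplane (R : realType) (n : nat) (r x : 'rV[R]_n) (t M : R) :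
  (0 < n)%N -> \sum_(i < n) r ord0 i = 1 -> 1 <= M ->
  exists (L : 'I_n -> R) (d : R), [/\ exists i, `|L i| = 1,
    forall i, `|L i| <= 1 &
    forall (p : 'rV[int]_n) (q : nat), (0 < q)%N ->
      q%:R < ((1 + n)`!%:R * M)^-1 * expR t ->
      (forall i, `|rat_disp r x t p q i| <= M) ->
      \sum_i L i * rat_disp r x t p q i = d].
Proof.
move=> hn hsum M1.
pose S : set 'rV[R]_(1 + n) := [set v | exists p q, [/\ (0 < q)%N,
  q%:R < ((1 + n)`!%:R * M)^-1 * expR t,
  forall i, `|rat_disp r x t p q i| <= M &
  v = row_mx 1 (\row_i rat_disp r x t p q i)]].
have [[v0 Sv0]|S0] := pselect (exists v, S v); last first.
  (* No rational point to contain: any normalized hyperplane will do. *)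
  exists (fun=> 1), 0; split => [|i|p q q0 qle hpq].
  - by exists (Ordinal hn); rewrite normr1.
  - by rewrite normr1.
  - by exfalso; apply: S0; exists (row_mx 1 (\row_i rat_disp r x t p q i)), p, q.
have det0 (A : 'M[R]_(1 + n)) : (forall j, S (row j A)) -> \det A = 0.
  move=> /choice[p /choice[q hpq]].
  apply: (@det_rat_disp_eq0 _ _ r x t M p q A hsum M1) => [j|j|j i|j];
    by have [] := hpq j.
have [u u0 uS] := orthogonal_of_det0 det0.
have uE (w : 'rV[R]_n) : S (row_mx 1 w) ->
    \sum_i w 0 i * dsubmx u i 0 = - usubmx u 0 0.
  move=> /uS; rewrite -[u in _ *m u]vsubmxK mul_row_col mul1mx.
  move=> /matrixP/(_ 0 0) /eqP.
  by rewrite [in X in X == _]mxE [X in _ == X]mxE addrC addr_eq0 mxE => /eqP.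
have ud0 : dsubmx u != 0.
  apply: contra u0 => /eqP ud0.
  have [p [q [_ _ _ v0E]]] := Sv0; rewrite v0E in Sv0.
  have := uE _ Sv0; rewrite ud0 big1 => [uu|i _]; last first.
    by rewrite [X in _ * X]mxE mulr0.
  rewrite -[u]vsubmxK ud0; apply/eqP.
  suff -> : usubmx u = 0 by rewrite col_mx0.
  apply/matrixP => i j; rewrite !ord1 [RHS]mxE.
  by apply/eqP; rewrite -oppr_eq0 -uu.
have [i0 _ i0max] := @arg_maxP _ _ _ (Ordinal hn) xpredT
  (fun i => `|dsubmx u i 0|) isT.
have ui0 : dsubmx u i0 0 != 0.
  apply: contra ud0 => /eqP ui0; apply/eqP/matrixP => i j.
  rewrite ord1 [RHS]mxE; apply/eqP; rewrite -normr_le0.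
  by have := i0max i isT; rewrite ui0 normr0.
exists (fun i => dsubmx u i 0 / dsubmx u i0 0),
  (- usubmx u 0 0 / dsubmx u i0 0).
split => [|i|p q q0 qle hpq].
- by exists i0; rewrite divff ?normr1.
- by rewrite normrM normfV ler_pdivrMr ?normr_gt0// mul1r; exact: i0max.
- rewrite -(uE (\row_i rat_disp r x t p q i)); last by exists p, q.
  rewrite mulr_suml; apply: eq_bigr => i _; rewrite [in RHS]mxE.
  by rewrite mulrAC [rat_disp _ _ _ _ _ _ * _]mulrC.
Qed.

(** * Dodging hyperplanes forces bad approximability *)

(** No rational point of denominator below [kappa * expR t] has [y] in the box
    of time [t] and size [rho] around it. *)
Definition away_from_rationals (R : realType) (n : nat) (r : 'rV[R]_n)
    (kappa rho t : R) (y : 'rV[R]_n) : Prop :=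
  forall (p : 'rV[int]_n) (q : nat), (0 < q)%N -> q%:R < kappa * expR t ->
    exists i, rho <= `|rat_disp r y t p q i|.

(** A rational point in the box of size [2 * M] lies on the hyperplane of
    [simplex_hyperplane], so [y] is far from it if it is far from the
    hyperplane; a rational point outside that box is at distance at least
    [M >= rho] from [y], which lies in the box of size [M]. *)
Lemma away_from_rationals_of_hyperplane (R : realType) (n : nat)
    (r x : 'rV[R]_n) (t M rho : R) :
  (0 < n)%N -> \sum_(i < n) r ord0 i = 1 -> 1 <= M -> rho <= M ->
  exists (L : 'I_n -> R) (d : R), [/\ exists i, `|L i| = 1,
    forall i, `|L i| <= 1 &
    forall y : 'rV[R]_n,
      (forall i, `|(y ord0 i - x ord0 i) * dilation r t i| <= M) ->
      n%:R * rho <=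
        `|\sum_i L i * ((y ord0 i - x ord0 i) * dilation r t i) - d| ->
      away_from_rationals r ((1 + n)`!%:R * (2 * M))^-1 rho t y].
Proof.
move=> hn hsum M1 rhoM.
have M21 : 1 <= 2 * M by lra.
have [L [d [Lmax L1 Ld]]] := simplex_hyperplane x t hn hsum M21.
exists L, d; split => // y yM yL p q q0 qle.
apply: contrapT => /forallNP far.
have {}far i : `|rat_disp r y t p q i| < rho by rewrite ltNge; apply/negP.
have dispE i : rat_disp r x t p q i =
    rat_disp r y t p q i + (y ord0 i - x ord0 i) * dilation r t i.
  by rewrite /rat_disp; ring.
have /(Ld _ _ q0 qle) dE : forall i, `|rat_disp r x t p q i| <= 2 * M.
  move=> i; rewrite dispE; apply: (le_trans (ler_normD _ _)).
  by have := far i; have := yM i; lra.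
have : n%:R * rho < n%:R * rho; last by rewrite ltxx.
apply: (le_lt_trans yL); rewrite distrC -dE -sumrB.
rewrite (le_lt_trans (ler_norm_sum _ _ _))//.
rewrite mulr_natl -[X in _ < _ *+ X](card_ord n) -sumr_const.
apply: ltr_sum => [|i _].
  by apply/hasP; exists (Ordinal hn); rewrite ?mem_index_enum.
rewrite -mulrBr normrM dispE addrK.
by rewrite (le_lt_trans _ (far i))// ler_piMl.
Qed.

(** For a given [q], let [k] be the first stage at which [q] is below
    [kappa * expR t].  Then [expR t <= C * q], where the first
    argument of the maximum [C] covers [k = 0] and the second one the case where
    stage [k - 1] came too early; so a box of size [rho] at time [t]
    has [i]-th side at least a constant times [q ^ (- (1 + r_i))]. *)
Lemma Bad_of_away (R : realType) (n : nat) (r : 'rV[R]_n)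
    (kappa rho t0 h : R) (y : 'rV[R]_n) :
  (forall i, 0 < r ord0 i) -> 0 < kappa -> 0 < rho -> 0 < h ->
  (forall k : nat, away_from_rationals r kappa rho (t0 + k%:R * h) y) ->
  Bad r y.
Proof.
move=> hr kappa0 rho0 h0 away.
pose C := Num.max (expR t0) (expR h / kappa).
have C0 : 0 < C by rewrite lt_max expR_gt0.
(* For each coordinate, the constant that makes [lowerE] below an equality. *)
pose c i := expR ((ln rho - (1 + r ord0 i) * ln C) / r ord0 i).
exists (\big[Num.min/1]_i c i).
  by apply: lt_bigmin => // i _; exact: expR_gt0.
move=> p q q0.
have q0' : 0 < q%:R :> R by rewrite ltr0n.
have exk : exists k : nat, q%:R < kappa * expR (t0 + k%:R * h).
  pose k := (Num.truncn `|(ln (q%:R / kappa) - t0) / h|).+1.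
  exists k.
  rewrite mulrC -ltr_pdivrMr// -[ltLHS]lnK ?posrE ?divr_gt0// ltr_expR.
  rewrite addrC -ltrBlDr -ltr_pdivrMr//.
  by apply: (le_lt_trans (ler_norm _)); rewrite truncnS_gt.
case: (ex_minnP exk) => k qk kmin.
have etk : expR (t0 + k%:R * h) <= C * q%:R.
  case: k qk kmin => [|k] qk kmin.
    rewrite mul0r addr0 (@le_trans _ _ C) ?le_max ?lexx//.
    by rewrite ler_pMr// ler1n.
  have : kappa * expR (t0 + k%:R * h) <= q%:R.
    by rewrite leNgt; apply/negP => /kmin; rewrite ltnn.
  rewrite -ler_pdivlMl// -natr1 [(_ + 1) * h]mulrDl mul1r addrA => qk'.
  rewrite expRD.
  rewrite (le_trans (ler_wpM2r (expR_ge0 _) qk'))//.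
  rewrite mulrC mulrA ler_wpM2r ?ler0n//.
  by rewrite /C le_max lexx orbT.
have [i rhoi] := away k p q q0 qk.
apply: (@le_trans _ _ (c i / q%:R)).
  by rewrite ler_wpM2r ?invr_ge0 ?ler0n//; exact: bigmin_le.
apply: le_trans (le_bigmax _ _ i).
have ri := hr i.
have Cq0 : 0 < C * q%:R by rewrite mulr_gt0.
pose lower := q%:R * (rho * expR (- ((1 + r ord0 i) * ln (C * q%:R)))).
have lower0 : 0 < lower by rewrite !mulr_gt0 ?expR_gt0.
have lowerE : c i / q%:R = lower `^ (1 / r ord0 i).
  rewrite /powR gt_eqF// /lower !lnM ?posrE ?mulr_gt0 ?expR_gt0// expRK.
  rewrite -[q%:R in LHS]lnK ?posrE// -expRN -expRD; congr expR.
  by field; rewrite gt_eqF.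
rewrite lowerE; apply: ge0_ler_powR; rewrite ?nnegrE ?divr_ge0 ?(ltW ri)
  ?(ltW lower0)//.
have -> : q%:R * y ord0 i - (p ord0 i)%:~R =
    - (q%:R * ((p ord0 i)%:~R / q%:R - y ord0 i)).
  by field; rewrite gt_eqF.
rewrite normrN normrM (gtr0_norm q0') ler_pM2l//.
move: rhoi; rewrite /rat_disp normrM (gtr0_norm (dilation_gt0 _ _ _)).
move=> /le_trans; rewrite expRN ler_pdivrMr ?expR_gt0//; apply.
rewrite ler_wpM2l// ler_expR ler_pM2l ?addr_gt0//.
by rewrite -[leLHS]expRK ler_ln ?posrE ?expR_gt0.
Qed.

(** * The winning strategy *)

Lemma rV_normP (R : realType) (n : nat) (v : 'rV[R]_n) (c : R) : 0 <= c ->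
  (`|v| <= c) <-> (forall i, `|v ord0 i| <= c).
Proof.
move=> c0; rewrite (_ : `|v| = mx_norm v)// mx_normrE; split => [vc i|vc].
  apply: le_trans vc.
  exact: (le_bigmax _ (fun ij : 'I_1 * 'I_n => `|v ij.1 ij.2|) (ord0, i)).
by apply: bigmax_le => // -[i j] _ /=; rewrite (ord1 i).
Qed.

Lemma Phi_coord (R : realType) (n : nat) (r : 'rV[R]_n) (t : R) (x : 'rV[R]_n)
    (i : 'I_n) : Phi r t x ord0 i = x ord0 i / dilation r t i.
Proof.
rewrite /Phi mul_mx_diag !mxE /dilation -expRN mulNr; congr (_ * expR (- _)).
Qed.

Lemma dilationD (R : realType) (n : nat) (r : 'rV[R]_n) (s t : R) (i : 'I_n) :
  dilation r (s + t) i = dilation r s i * dilation r t i.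
Proof. by rewrite /dilation mulrDr expRD. Qed.

Lemma dilation_ge (R : realType) (n : nat) (r : 'rV[R]_n) (t : R) (i : 'I_n) :
  0 <= r ord0 i -> 0 <= t -> expR t <= dilation r t i.
Proof. by move=> ri t0; rewrite ler_expR mulrDl mul1r lerDl mulr_ge0. Qed.

Lemma nbhs_rV_box (R : realType) (n : nat) (x : 'rV[R]_n) (A : set 'rV[R]_n) :
  nbhs x A -> exists2 e : R, 0 < e <= 1 &
    forall y : 'rV[R]_n, (forall i, `|y ord0 i - x ord0 i| < e) -> A y.
Proof.
move=> /nbhs_ballP[e /= e0 eA]; exists (Num.min e 1).
  by rewrite lt_min e0 ltr01 ge_min lexx orbT.
move=> y xy; apply: eA; split => // i j; rewrite (ord1 i) -ball_normE /= distrC.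
by have := xy j; rewrite lt_min => /andP[].
Qed.

(** Moving [z] by [rho] forwards and backwards along an axis where [L] has
    entry of modulus 1 changes the value of [L] by [2 * rho] in total, so
    one of the two ends has value at distance at least [rho] from [d]. *)
Lemma exists_off_hyperplane (R : realType) (n : nat) (L : 'I_n -> R) (d rho : R)
    (z : 'rV[R]_n) : 0 <= rho -> (exists i, `|L i| = 1) ->
  exists v : 'rV[R]_n, (forall i, `|v ord0 i - z ord0 i| <= rho) /\
    rho <= `|\sum_i L i * v ord0 i - d|.
Proof.
move=> rho0 [i0 Li0].
pose v (s : R) : 'rV[R]_n := z + s *: delta_mx 0 i0.
have vs (s : R) : `|s| = rho -> forall i, `|v s ord0 i - z ord0 i| <= rho.
  move=> sr i; rewrite !mxE [z _ _ + _]addrC addrK eqxx /=.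
  by case: (i == i0); rewrite ?mulr1 ?mulr0 ?normr0// sr.
have vL (s : R) : \sum_i L i * v s ord0 i = \sum_i L i * z ord0 i + s * L i0.
  rewrite (eq_bigr (fun i => L i * z ord0 i + (i == i0)%:R * (s * L i))).
    rewrite big_split /=; congr (_ + _).
    by rewrite (bigD1 i0)//= eqxx mul1r big1 ?addr0// => i /negbTE ->; rewrite mul0r.
  by move=> i _; rewrite !mxE eqxx/=; ring.
have [h|h] := leP rho `|\sum_i L i * v rho ord0 i - d|.
  by exists (v rho); split => //; apply: vs; rewrite ger0_norm.
exists (v (- rho)); split; first by apply: vs; rewrite normrN ger0_norm.
rewrite leNgt; apply/negP => h'.
have : `|(\sum_i L i * v rho ord0 i - d) - (\sum_i L i * v (- rho) ord0 i - d)|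
    < rho + rho by rewrite (le_lt_trans (ler_normB _ _))// ltrD.
rewrite !vL.
have -> : \sum_i L i * z ord0 i + rho * L i0 - d -
    (\sum_i L i * z ord0 i + - rho * L i0 - d) = 2 * rho * L i0 by ring.
by rewrite normrM Li0 mulr1 ger0_norm ?mulr_ge0// mulrDl mul1r ltxx.
Qed.

(** The strategy depends on Bob's last move only.  Let [D0] contain
    a box of size [e] around [z0] and be contained in the one of size [M]
    around 0.  In rescaled coordinates Alice centres her move at a
    point at distance at most [e / 2] from [z0], where the functional of the
    hyperplane is at least [e / 2] away from [d].  The choice of [a] makes her
    set so small (size [rho = e / (4 n)]) that it stays in [D0] and that the
    functional remains [e / 4 = n * rho] away from [d]. *)
Lemma Bad_winning (R : realType) (n : nat) (r : 'rV[R]_n) (D0 : set 'rV[R]_n)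
    (astar : R) :
  (0 < n)%N -> (forall i, 0 < r ord0 i) -> \sum_(i < n) r ord0 i = 1 ->
  admissible D0 -> 0 <= astar -> winning (Phi r) D0 astar (Bad r).
Proof.
move=> hn hr hsum [D0c [z0 z0D]] astar0.
have [M M1 DM] : exists2 M : R, 1 <= M &
    forall z, D0 z -> forall i, `|z ord0 i| <= M.
  have /pinfty_ex_gt0[M M0 hM] := compact_bounded D0c.
  exists (Num.max M 1); first by rewrite le_max lexx orbT.
  move=> z D0z; apply/rV_normP; first by rewrite le_max (ltW M0).
  by rewrite le_max hM.
have [e /andP[e0 e1] eD] := nbhs_rV_box z0D.
have n0 : 0 < n%:R :> R by rewrite ltr0n.
have n1 : 1 <= n%:R :> R by rewrite ler1n.
pose rho : R := e / (4 * n%:R).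
have rho0 : 0 < rho by rewrite divr_gt0// mulr_gt0.
have rhoe : rho <= e / 4.
  by rewrite ler_pM2l// lef_pV2 ?posrE ?mulr_gt0// ler_peMr.
have nrho : n%:R * rho = e / 4 by rewrite /rho; field; rewrite gt_eqF.
have rhoM : rho <= M by apply: (le_trans rhoe); lra.
pose a : R := Num.max (astar + 1) (ln (M / rho)).
have aa : astar < a by rewrite lt_max ltrDl ltr01.
have a0 : 0 < a by apply: le_lt_trans aa.
have M0 : 0 < M by apply: lt_le_trans M1.
have aM (i : 'I_n) (c : R) : `|c| <= M -> `|c / dilation r a i| <= rho.
  move=> cM; have D1 := dilation_gt0 r a i.
  rewrite normrM normfV (gtr0_norm D1) ler_pdivrMr// (le_trans cM)//.
  rewrite -ler_pdivrMl// mulrC.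
  apply: le_trans (dilation_ge (ltW (hr i)) (ltW a0)).
  have Mrho0 : 0 < M / rho by rewrite divr_gt0.
  by rewrite -[leLHS](lnK Mrho0) ler_expR le_max lexx orbT.
pose kappa : R := ((1 + n)`!%:R * (2 * M))^-1.
have kappa0 : 0 < kappa.
  by rewrite invr_gt0 !mulr_gt0// ltr0n fact_gt0.
have good (w : position R n) : exists x' : 'rV[R]_n,
    psi (Phi r) D0 (x', w.2 + a) `<=` psi (Phi r) D0 w /\
    forall y, psi (Phi r) D0 (x', w.2 + a) y ->
      away_from_rationals r kappa rho w.2 y.
  case: w => x t /=.
  have [L [d [Lmax L1 Ld]]] :=
    away_from_rationals_of_hyperplane x t hn hsum M1 rhoM.
  have e20 : 0 <= e / 2 by rewrite divr_ge0// ltW.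
  have [v [vz vL]] := exists_off_hyperplane d z0 e20 Lmax.
  exists (Phi r t v + x).
  (* The rescaled coordinates of the points of Alice's set. *)
  pose u (z : 'rV[R]_n) : 'rV[R]_n := \row_i (v ord0 i + z ord0 i / dilation r a i).
  have uE z : Phi r (t + a) z + (Phi r t v + x) = Phi r t (u z) + x.
    apply/rowP => i; rewrite [LHS]mxE [X in _ + X]mxE [RHS]mxE !Phi_coord mxE.
    rewrite dilationD.
    by field; rewrite !gt_eqF ?dilation_gt0.
  have uD z : D0 z -> D0 (u z).
    move=> Dz; apply: eD => i; rewrite mxE.
    have := aM i _ (DM z Dz i); have := vz i.
    move=> h1 h2; rewrite addrAC (le_lt_trans (ler_normD _ _))//.
    apply: (@le_lt_trans _ _ (e / 2 + e / 4)); last by lra.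
    by apply: lerD => //; apply: le_trans rhoe.
  split => y [z Dz <-] /=; rewrite uE; first by exists (u z) => //; exact: uD.
  have uy i : ((Phi r t (u z) + x) ord0 i - x ord0 i) * dilation r t i
      = u z ord0 i.
    by rewrite mxE addrK Phi_coord divfK// gt_eqF// dilation_gt0.
  apply: Ld => [i|]; first by rewrite uy; apply: DM; exact: uD.
  rewrite (eq_bigr (fun i => L i * v ord0 i + L i * (z ord0 i / dilation r a i))).
    rewrite big_split /= addrAC nrho.
    have : `|\sum_i L i * (z ord0 i / dilation r a i)| <= n%:R * rho.
      rewrite (le_trans (ler_norm_sum _ _ _))//.
      rewrite mulr_natl -[X in _ <= _ *+ X](card_ord n) -sumr_const.
      apply: ler_sum => i _; rewrite normrM.
      by apply: (le_trans _ (aM i _ (DM z Dz i))); rewrite ler_piMl.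
    rewrite nrho; move: vL; set p := \sum_i _ - d; set s := \sum_i _ => vL sL.
    have := lerB_normD p s; lra.
  by move=> i _; rewrite uy mxE mulrDr.
have [alice ha] := choice good.
pose origin : position R n := (0, 0).
exists a => // b bb; exists (fun s => alice (last origin s)) => w; split.
  move=> k _; rewrite /alice_legal /alice_move mkseqS last_rcons.
  exact: (ha _).1.
move=> legal y yw.
have w2 k : (w k).2 = (w 0%N).2 + k%:R * (a + b).
  elim: k => [|k IH]; first by rewrite mul0r addr0.
  by rewrite (legal k).1 IH -natr1; ring.
apply: (@Bad_of_away _ _ _ kappa rho (w 0%N).2 (a + b)) => // [|k].
  by rewrite addr_gt0// (le_lt_trans astar0).
rewrite -w2; apply: (ha _).2.
have := (legal k).2 _ (yw k.+1 I).
by rewrite /alice_move mkseqS last_rcons.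
Qed.

(** * The Hausdorff dimension of R^n *)

Lemma hausdorff_gauge_ge0 (R : realType) (V : normedModType R) (s : R)
    (A : set V) : (0 <= hausdorff_gauge s A)%E.
Proof. by rewrite /hausdorff_gauge; case: ifP => // _; exact: poweR_ge0. Qed.

Lemma diameter_ge0 (R : realType) (V : normedModType R) (A : set V) :
  A !=set0 -> (0 <= diameter A)%E.
Proof.
move=> [z Az]; apply: ereal_sup_ubound; exists (z, z) => //=.
by rewrite subrr normr0.
Qed.

Lemma hausdorff_gauge_le (R : realType) (V : normedModType R) (s e : R)
    (A : set V) : 0 <= s -> (diameter A <= e%:E)%E ->
  (hausdorff_gauge s A <= (e `^ s)%:E)%E.
Proof.
move=> s0 dA; rewrite /hausdorff_gauge; case: ifP => [_|/negbT/set0P A0].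
  by rewrite lee_fin powR_ge0.
have d0 := diameter_ge0 A0.
rewrite -poweR_EFin; apply: gt0_ler_poweR => //; rewrite in_itv/= leey andbT//.
exact: le_trans dA.
Qed.

Lemma hausdorff_measure_eq0P (R : realType) (V : normedModType R) (s : R)
    (A : set V) :
  hausdorff_measure s A = 0%E <->
  forall delta eta : R, 0 < delta -> 0 < eta -> exists U : (set V)^nat,
    [/\ A `<=` \bigcup_i U i, forall i, (diameter (U i) <= delta%:E)%E &
    (\sum_(0 <= i <oo) hausdorff_gauge s (U i) < eta%:E)%E].
Proof.
have pre0 delta : (0 <= hausdorff_premeasure s delta A)%E.
  apply: le_ereal_inf_tmp => _ [U _ <-].
  by apply: nneseries_ge0 => i _ _; exact: hausdorff_gauge_ge0.
split => [H0 delta eta delta0 eta0|H].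
  have : (hausdorff_premeasure s delta A < eta%:E)%E.
    apply: (@le_lt_trans _ _ 0%E); last by rewrite lte_fin.
    by rewrite -H0; apply: ereal_sup_ubound; exists delta.
  by move=> /ereal_inf_lt[_ [U [AU dU] <-] Ueta]; exists U.
apply/eqP; rewrite eq_le; apply/andP; split.
  apply: ge_ereal_sup => _ [delta /= delta0 <-].
  apply/lee_addgt0Pr => eta eta0; rewrite add0e.
  have [U [AU dU Ueta]] := H delta eta delta0 eta0.
  by apply: ereal_inf_le; exists (\sum_(0 <= i <oo) hausdorff_gauge s (U i))%E;
    [exists U|exact: ltW].
by apply: le_trans (pre0 1) _; apply: ereal_sup_ubound; exists 1 => //=.
Qed.

Lemma flatten_double_cover (R : realType) (V : normedModType R) (s : R)
    (W : nat -> (set V)^nat) :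
  exists U : (set V)^nat,
    [/\ \bigcup_i U i = \bigcup_l \bigcup_j W l j,
    forall i, exists l j, U i = W l j &
    (\sum_(0 <= i <oo) hausdorff_gauge s (U i) =
     \sum_(0 <= l <oo) \sum_(0 <= j <oo) hausdorff_gauge s (W l j))%E].
Proof.
have /ppcard_eqP[f] : ([set: nat] #= [set: nat * nat])%card.
  by rewrite card_eq_sym; exact: card_nat2.
exists (fun i => W (f i).1 (f i).2); split.
- apply/seteqP; split => [x [i _ Wx]|x [l _ [j _ Wx]]].
    by exists (f i).1 => //; exists (f i).2.
  have [i _ fi] := 'surj_f (I : [set: nat * nat] (l, j)).
  by exists i => //=; rewrite fi.
- by move=> i; exists (f i).1, (f i).2.
- rewrite nneseries_esumT; last by move=> i; exact: hausdorff_gauge_ge0.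
  rewrite -(@reindex_esum _ _ _ [set: nat] [set: nat * nat] f
    (fun k => hausdorff_gauge s (W k.1 k.2))); last exact: 'bij_f.
  rewrite [RHS]nneseries_esumT; last first.
    move=> l; apply: nneseries_ge0 => i _ _; exact: hausdorff_gauge_ge0.
  rewrite [RHS](eq_esum (b := fun l =>
    (\esum_(j in [set: nat]) hausdorff_gauge s (W l j)))%E); last first.
    by move=> l _; rewrite nneseries_esumT// => j; exact: hausdorff_gauge_ge0.
  rewrite (@esum_esum _ _ _ setT (fun=> setT)
    (fun l j => hausdorff_gauge s (W l j))); last first.
    by move=> *; exact: hausdorff_gauge_ge0.
  by congr (esum _ _); apply/seteqP; split => //.
Qed.

(** The grid of mesh [1 / N] on the cube of half-side [l] has
    [(2 l N)^n] cells, so its contribution to the sum of [s]-th powers is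
    of order [N ^ (n - s)]. *)
Lemma fine_grid (R : realType) (n l : nat) (s delta eta : R) :
  n%:R < s -> 0 < delta -> 0 < eta ->
  exists N : nat, [/\ (0 < N)%N, N%:R^-1 <= delta &
    ((2 * l * N) ^ n)%N%:R * N%:R^-1 `^ s <= eta].
Proof.
move=> ns delta0 eta0.
have sn : 0 < s - n%:R by rewrite subr_gt0.
pose X := ((2 * l) ^ n)%N%:R / eta.
have X0 : 0 <= X by rewrite divr_ge0 ?ler0n// ltW.
pose Y := (X + 1) `^ (s - n%:R)^-1 + delta^-1.
exists (Num.truncn Y).+1; set N := (Num.truncn Y).+1.
have YN : Y < N%:R by rewrite truncnS_gt.
have N0 : 0 < N%:R :> R by rewrite ltr0n.
split => //.
  rewrite -[leRHS]invrK lef_pV2 ?posrE ?invr_gt0//.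
  by apply: le_trans (ltW YN); rewrite lerDr powR_ge0.
have XN : X <= N%:R `^ (s - n%:R).
  apply: (@le_trans _ _ (((X + 1) `^ (s - n%:R)^-1) `^ (s - n%:R))).
    by rewrite -powRrM mulVf ?gt_eqF// powRr1 ?addr_ge0// lerDl.
  apply: ge0_ler_powR; rewrite ?nnegrE ?powR_ge0 ?ler0n ?(ltW sn)//.
  by apply: le_trans (ltW YN); rewrite lerDl invr_ge0 ltW.
have -> : N%:R^-1 `^ s = (N%:R ^+ n * N%:R `^ (s - n%:R))^-1 :> R.
  rewrite -[N%:R^-1]powR_inv1 ?ler0n// -powRrM mulN1r powRN.
  rewrite -[N%:R ^+ n]powR_mulrn ?ler0n// -powRD ?subrKC// ?addrC ?subrK//.
  by apply/implyP => _; rewrite gt_eqF.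
rewrite expnMn natrM [(N ^ n)%:R]natrX invfM -mulrA mulVKf; last first.
  by rewrite expf_neq0// gt_eqF.
by rewrite ler_pdivrMr ?powR_gt0// mulrC -ler_pdivrMr.
Qed.

(** The cubes [-l, l]^n exhaust R^n, and the [l]-th one can be divided so finely
    that it contributes at most [eta / 2 ^ (l + 2)]. *)
Lemma hausdorff_measure_gt_dim (R : realType) (n : nat) (s : R)
    (A : set 'rV[R]_n) : n%:R < s -> hausdorff_measure s A = 0%E.
Proof.
move=> ns; apply/hausdorff_measure_eq0P => delta eta delta0 eta0.
have s0 : 0 <= s by apply: le_trans (ltW ns).
have eta20 : 0 < eta / 2 by rewrite divr_gt0.
have /choice[N hN] : forall l : nat, exists N : nat,
    [/\ (0 < N)%N, N%:R^-1 <= delta &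
    ((2 * l * N) ^ n)%N%:R * N%:R^-1 `^ s <= (eta / 2) / (2 ^ l.+1)%:R].
  by move=> l; apply: fine_grid => //; rewrite divr_gt0// ltr0n expn_gt0.
pose T l := {ffun 'I_n -> 'I_(2 * l * N l)}.
pose cube l (f : T l) : set 'rV[R]_n := [set x | forall i,
  (f i)%:R / (N l)%:R - l%:R <= x ord0 i <= (f i).+1%:R / (N l)%:R - l%:R].
have cube_diam l f : (diameter (@cube l f) <= ((N l)%:R^-1)%:E)%E.
  apply: ge_ereal_sup => _ [[x y] /= [xc yc] <-].
  rewrite lee_fin; apply/rV_normP; first by rewrite invr_ge0.
  move=> i; rewrite !mxE ler_norml.
  have /andP[] := xc i; have /andP[] := yc i.
  by rewrite -natr1 mulrDl mul1r => *; apply/andP; split; lra.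
pose W l j : set 'rV[R]_n :=
  if insub j is Some k then cube l (enum_val (k : 'I_#|T l|)) else set0.
have W_diam l j : (diameter (W l j) <= ((N l)%:R^-1)%:E)%E.
  rewrite /W; case: insub => [k|]; first exact: cube_diam.
  apply: ge_ereal_sup => _ [z [[]]].
have [U [UW Umem Usum]] := flatten_double_cover s W.
exists U; split.
- move=> x _; rewrite UW.
  pose l := (Num.truncn `|x|).+1.
  have lx i : `|x ord0 i| < l%:R.
    apply: (@le_lt_trans _ _ `|x|); last by rewrite truncnS_gt.
    exact: (rV_normP x (normr_ge0 x)).1.
  have [N0 _ _] := hN l.
  have N0' : 0 < (N l)%:R :> R by rewrite ltr0n.
  pose y i := (x ord0 i + l%:R) * (N l)%:R.
  have y0 i : 0 <= y i.
    by rewrite mulr_ge0// ?ler0n//; have := lx i; rewrite ltr_norml; lra.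
  have fP i : (Num.truncn (y i) < 2 * l * N l)%N.
    rewrite -(ltr_nat R); apply: (@le_lt_trans _ _ (y i)).
      by rewrite truncn_le.
    rewrite natrM ltr_pM2r// natrM mulr_natl mulr2n ltrD2r.
    by have := lx i; rewrite ltr_norml => /andP[].
  pose f : T l := [ffun i => Ordinal (fP i)].
  exists l => //; exists (enum_rank f) => //.
  rewrite /W; case: insubP => [k _ kf|]; last by rewrite ltn_ord.
  have -> : k = enum_rank f by exact: val_inj.
  rewrite enum_rankK => i; rewrite ffunE /=.
  rewrite lerBlDr ler_pdivrMr// lerBrDr ler_pdivlMr//.
  by apply/andP; split; [rewrite truncn_le|rewrite ltW// truncnS_gt].
- move=> i; have [l [j ->]] := Umem i; apply: le_trans (W_diam l j) _.
  by rewrite lee_fin; have [] := hN l.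
- rewrite Usum; apply: (@le_lt_trans _ _ (eta / 2)%:E); last first.
    by rewrite lte_fin ltr_pdivrMr// ltr_pMr// ltr1n.
  apply: le_trans (epsilon_trick0 xpredT (ltW eta20)).
  apply: lee_nneseries => l *.
    by apply: nneseries_ge0 => *; exact: hausdorff_gauge_ge0.
  rewrite (nneseries_split 0 #|T l|); last first.
    by move=> *; exact: hausdorff_gauge_ge0.
  rewrite add0n eseries0 ?adde0 => [|j Tj _]; last first.
    rewrite /W; case: insubP => [k|_].
      by rewrite ltnNge Tj.
    by rewrite /hausdorff_gauge eqxx.
  apply: (@le_trans _ _ (\sum_(0 <= j < #|T l|) ((N l)%:R^-1 `^ s)%:E)%E).
    by apply: lee_sum => j _; exact: hausdorff_gauge_le.
  rewrite big_mkord sumEFin sumr_const card_ord lee_fin.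
  rewrite /T card_ffun !card_ord -[_ *+ (_ ^ _)]mulr_natl.
  by have [] := hN l.
Qed.

(** * Escaping a cover along a tree *)

(** The proportion of the descendants of [v], [m] generations below,
    that satisfy [P], in the tree where the children of [v] are the
    [step v c] with [Q c]. *)
Fixpoint density (R : realType) (X : Type) (C : finType) (Q : pred C)
    (step : X -> C -> X) (P : pred X) (m : nat) (v : X) : R :=
  if m is m'.+1 then
    (\sum_(c | Q c) density R Q step P m' (step v c)) / #|Q|%:R
  else (P v)%:R.

Lemma density_ge0 (R : realType) (X : Type) (C : finType) (Q : pred C)
    (step : X -> C -> X) (P : pred X) (m : nat) (v : X) :
  0 <= density R Q step P m v.
Proof.
elim: m v => [|m IH] v /=; first by case: (P v).
by rewrite divr_ge0 ?ler0n// sumr_ge0.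
Qed.

Lemma density_eq0 (R : realType) (X : Type) (C : finType) (Q : pred C)
    (step : X -> C -> X) (P : pred X) (m : nat) (v : X) :
  (forall v, ~~ P v) -> density R Q step P m v = 0.
Proof.
move=> P0; elim: m v => [|m IH] v /=; first by rewrite (negbTE (P0 v)).
by rewrite big1 ?mul0r.
Qed.

(** For [m = 0] this holds because [P] passes from a child to its parent; this
    lets the two cases be treated together through [m.-1]. *)
Lemma density_children (R : realType) (X : Type) (C : finType) (Q : pred C)
    (step : X -> C -> X) (P : pred X) (m : nat) (v : X) :
  (0 < #|Q|)%N -> (forall v c, Q c -> P (step v c) -> P v) ->
  \sum_(c | Q c) density R Q step P m.-1 (step v c) <=
    #|Q|%:R * density R Q step P m v.
Proof.
move=> Q0 Pup; have Q0' : 0 < #|Q|%:R :> R by rewrite ltr0n.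
case: m => [|m] /=; last by rewrite mulrC divfK// gt_eqF.
rewrite mulr_natl -sumr_const; apply: ler_sum => c Qc.
by have := Pup v c Qc; case: (P (step v c)) => [->|_]; rewrite ?ler0n.
Qed.

(** Let [W i v] be the total density, below a vertex [v] of generation [i], of
    the predicates [P j] looked at in generation [k j].  The average of [W] over
    the children of [v] is at most [W i v], so a branch along
    which [W < 1] exists.  In generation [k j] the density of [P j] is 0 or
    1, hence 0.  This is the argument that a set of measure less than 1 misses
    a point, without a measure. *)
Lemma greedy_branch (R : realType) (X : Type) (C : finType) (Q : pred C)
    (step : X -> C -> X) (P : nat -> pred X) (k : nat -> nat) (v0 : X) :
  (0 < #|Q|)%N -> (forall j v c, Q c -> P j (step v c) -> P j v) ->
  (\sum_(0 <= j <oo) (density R Q step (P j) (k j) v0)%:E < 1)%E ->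
  exists v : nat -> X, [/\ v 0%N = v0,
    forall i, exists2 c, Q c & v i.+1 = step (v i) c &
    forall j, ~~ P j (v (k j))].
Proof.
move=> Q0 Pup W0; have Q0' : 0 < #|Q|%:R :> R by rewrite ltr0n.
(* The truncated subtraction freezes the [j]-th term after generation [k j]. *)
pose W i v := (\sum_(0 <= j <oo) (density R Q step (P j) (k j - i) v)%:E)%E.
have dens0 m v j : (0 <= (density R Q step (P j) m v)%:E)%E.
  by rewrite lee_fin density_ge0.
have next (iv : nat * X) : exists c, Q c /\
    ((W iv.1 iv.2 < 1)%E -> (W iv.1.+1 (step iv.2 c) < 1)%E).
  case: iv => i v /=.
  have [c0 Qc0] : exists c, Q c by exact/card_gt0P.
  have [W1|_] := boolP (W i v < 1)%E; last by exists c0.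
  apply: contrapT => /forallNP noc.
  have big c : Q c -> (1 <= W i.+1 (step v c))%E.
    by move=> Qc; rewrite leNgt; apply/negP => lt1; apply: (noc c).
  have : (#|Q|%:R%:E <= #|Q|%:R%:E * W i v)%E.
    apply: (@le_trans _ _ (\sum_(c | Q c) W i.+1 (step v c))%E).
      rewrite -sumr_const -sumEFin; exact: lee_sum.
    rewrite /W -nneseries_sum// -nneseriesZl//.
    apply: lee_nneseries => j *.
      by rewrite sumEFin lee_fin sumr_ge0// => *; exact: density_ge0.
    rewrite sumEFin subnS -EFinM lee_fin.
    by apply: density_children => //; exact: Pup.
  rewrite -[X in (X <= _)%E]mule1 lee_pmul2l ?lte_fin//.
  by rewrite leNgt W1.
have [f hf] := choice next.
pose v := fix v i := if i is i'.+1 then step (v i') (f (i', v i')) else v0.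
exists v; split => // [i|j].
  by exists (f (i, v i)) => //; have [] := hf (i, v i).
have W1 i : (W i (v i) < 1)%E.
  elim: i => [|i IH]; last by have [_ /(_ IH)] := hf (i, v i).
  by rewrite /W; under eq_eseriesr do rewrite subn0.
apply: contraTN (W1 (k j)) => Pj; rewrite -leNgt.
rewrite /W (nneseries_split 0 j.+1)// add0n big_nat_recr//= subnn /= Pj.
rewrite addeAC leeDr// adde_ge0// ?nneseries_ge0// ?sume_ge0//.
Qed.

(** * The game played with cubes *)

Definition cube (R : realType) (n : nat) : set 'rV[R]_n :=
  [set x | forall i, `|x ord0 i| <= 1].

Lemma admissible_cube (R : realType) (n : nat) : admissible (@cube R n).
Proof.
have cubeE : @cube R n = closed_ball (0 : 'rV[R]_n) 1.
  rewrite closed_ballE//; apply/seteqP.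
  by split => x /=; rewrite /closed_ball_ /= sub0r normrN (rV_normP _ ler01).
split; last first.
  by exists 0; rewrite cubeE interior_closed_ballE//; exact: ballxx.
apply: bounded_closed_compact; last by rewrite cubeE; exact: closed_ball_closed.
exists 1; split => // M M1 x /(rV_normP x ler01) x1.
exact: le_trans (ltW M1).
Qed.

Lemma psi_cubeP (R : realType) (n : nat) (r : 'rV[R]_n) (w : position R n)
    (y : 'rV[R]_n) :
  psi (Phi r) (@cube R n) w y <->
  forall i, `|y ord0 i - w.1 ord0 i| <= (dilation r w.2 i)^-1.
Proof.
case: w => x t /=; split => [[z zc <-] i|yx].
  rewrite mxE addrK Phi_coord normrM normfV (gtr0_norm (dilation_gt0 _ _ _)).
  by rewrite ler_piMl// invr_ge0 ltW// dilation_gt0.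
exists (\row_i ((y ord0 i - x ord0 i) * dilation r t i)).
  move=> i; rewrite mxE normrM (gtr0_norm (dilation_gt0 _ _ _)).
  by rewrite -ler_pdivlMr ?dilation_gt0// mul1r.
apply/rowP => i; rewrite mxE [X in _ + X](_ : _ = x ord0 i); last by [].
rewrite [X in X + _](_ : _ = y ord0 i - x ord0 i); first by rewrite subrK.
by rewrite Phi_coord mxE mulfK// gt_eqF// dilation_gt0.
Qed.

Lemma pos_le_cube (R : realType) (n : nat) (r : 'rV[R]_n)
    (w w' : position R n) (i : 'I_n) :
  pos_le (Phi r) (@cube R n) w' w ->
  w.1 ord0 i - (dilation r w.2 i)^-1 <= w'.1 ord0 i - (dilation r w'.2 i)^-1
  /\ w'.1 ord0 i + (dilation r w'.2 i)^-1 <= w.1 ord0 i + (dilation r w.2 i)^-1.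
Proof.
move=> ww'.
have corner (e : R) : `|e| <= 1 ->
    `|w'.1 ord0 i + e / dilation r w'.2 i - w.1 ord0 i| <= (dilation r w.2 i)^-1.
  move=> e1; pose y := \row_j (w'.1 ord0 j + e / dilation r w'.2 j).
  have /psi_cubeP/(_ i) : psi (Phi r) (@cube R n) w y; last by rewrite mxE.
  apply/ww'/psi_cubeP => j; rewrite mxE addrAC subrr add0r normrM normfV.
  by rewrite (gtr0_norm (dilation_gt0 _ _ _)) ler_piMl// invr_ge0 ltW// dilation_gt0.
have := corner 1; have := corner (-1); rewrite normrN normr1 lexx.
move=> /(_ isT) + /(_ isT); rewrite !ler_norml mulN1r mul1r; lra.
Qed.

Lemma is_astar_cube (R : realType) (n : nat) (r : 'rV[R]_n) :
  (forall i, 0 <= r ord0 i) -> is_astar (Phi r) (@cube R n) 0.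
Proof.
move=> hr; split => // s s0 x t; exists x => y; rewrite !psi_cubeP => yx i.
apply: le_trans (yx i) _; rewrite /= lef_pV2 ?posrE ?dilation_gt0// dilationD.
rewrite ler_peMr ?ltW ?dilation_gt0//.
rewrite (lt_le_trans _ (dilation_ge (hr i) (ltW s0)))//.
by rewrite expR_gt1.
Qed.

(** Making Alice move legally even after illegal moves of Bob
    lets the inclusion of boxes hold at all vertices of the tree of
    histories; the outcome of legal plays is unchanged. *)
Lemma always_legal_strategy (R : realType) (n : nat)
    (F : R -> 'rV[R]_n -> 'rV[R]_n) (D0 S : set 'rV[R]_n) (astar a b : R)
    (w0 : position R n) :
  is_astar F D0 astar -> astar < a -> ab_winning F D0 a b S ->
  exists sigma : strategy R n,
    (forall h, pos_le F D0 (sigma h, (last w0 h).2 + a) (last w0 h)) /\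
    forall w, (forall k, bob_legal F D0 a b sigma w k) ->
      \bigcap_k psi F D0 (w k) `<=` S.
Proof.
move=> [_ hastar] aa [sigma hsigma].
have ex_stay (w : position R n) : exists x', pos_le F D0 (x', w.2 + a) w.
  by case: w => x t; exact: hastar.
have [stay hstay] := choice ex_stay.
pose sigma' h := if `[< pos_le F D0 (sigma h, (last w0 h).2 + a) (last w0 h) >]
  then sigma h else stay (last w0 h).
exists sigma'; split => [h|w legal'].
  by rewrite /sigma'; case: asboolP.
have move_eq k : (forall j, (j < k)%N -> bob_legal F D0 a b sigma w j) ->
    alice_move a sigma' w k = alice_move a sigma w k.
  move=> /(hsigma w).1; rewrite /alice_legal /alice_move /sigma' => leg.
  by rewrite mkseqS last_rcons -mkseqS asboolT.
have legal k : bob_legal F D0 a b sigma w k.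
  elim/ltn_ind: k => k IH.
  by have [e le] := legal' k; split => //; rewrite -move_eq.
by have [_] := hsigma w; apply.
Qed.

(** In each coordinate, the supremum of the lower ends of the nested intervals
    lies in all of them. *)
Lemma psi_cube_nested (R : realType) (n : nat) (r : 'rV[R]_n)
    (w : nat -> position R n) :
  (forall k, pos_le (Phi r) (@cube R n) (w k.+1) (w k)) ->
  exists x, forall k, psi (Phi r) (@cube R n) (w k) x.
Proof.
move=> nested.
pose lo i k := (w k).1 ord0 i - (dilation r (w k).2 i)^-1.
pose hi i k := (w k).1 ord0 i + (dilation r (w k).2 i)^-1.
have lo_mono i : {homo lo i : k l / (k <= l)%N >-> k <= l}.
  apply: homo_leq => [k|? ? ?|k] //; first exact: le_trans.
  by have [] := pos_le_cube i (nested k).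
have hi_mono i : {homo hi i : k l / (k <= l)%N >-> l <= k}.
  apply: (homo_leq (r := fun x y : R => y <= x)) => [k|? ? ? h1 h2|k] //.
    exact: le_trans h2 h1.
  by have [] := pos_le_cube i (nested k).
have lo_hi i k l : lo i k <= hi i l.
  apply: (le_trans (lo_mono i _ _ (leq_maxl k l))).
  apply: le_trans (hi_mono i _ _ (leq_maxr k l)).
  have := dilation_gt0 r (w (maxn k l)).2 i; rewrite /lo /hi -invr_gt0; lra.
exists (\row_i sup (range (lo i))) => k; apply/psi_cubeP => i; rewrite mxE.
have lox : lo i k <= sup (range (lo i)).
  apply: sup_upper_bound; last by exists k.
  by split; [exists (lo i 0%N), 0%N|exists (hi i 0%N) => _ [l _ <-]].
have xhi : sup (range (lo i)) <= hi i k.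
  by apply: ge_sup; [exists (lo i 0%N), 0%N|move=> _ [l _ <-]].
by move: lox xhi; rewrite /lo /hi ler_norml; lra.
Qed.

(** * Bob's tree of grid moves *)

(** A position used only as the last element of the empty history. *)
Definition origin (R : realType) (n : nat) : position R n := (0, 0).

(** The number of intervals of time [t + b] that fit side by side, along the
    [i]-th axis, in an interval of time [t]. *)
Definition grid_size (R : realType) (n : nat) (r : 'rV[R]_n) (b : R)
    (i : 'I_n) : nat := Num.truncn (dilation r b i).

Definition grid_max (R : realType) (n : nat) (r : 'rV[R]_n) (b : R) : nat :=
  \max_(i < n) grid_size r b i.

(** The cells of the grid.  The bound [grid_max] common to all axes makes the
    type of codes a type of ordinary finite functions, over which products of
    sums expand. *)
Definition grid (R : realType) (n : nat) (r : 'rV[R]_n) (b : R) :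
    pred {ffun 'I_n -> 'I_(grid_max r b)} :=
  [pred c in family (fun i (j : 'I_(grid_max r b)) => (j < grid_size r b i)%N)].

Arguments grid [R n] r b c.

(** Bob's answer to Alice's move after the history [h]: the box that occupies
    the cell [c] of the grid that starts at the lower corner of her box. *)
Definition grid_move (R : realType) (n : nat) (r : 'rV[R]_n) (a b : R)
    (sigma : strategy R n) (h : seq (position R n))
    (c : {ffun 'I_n -> 'I_(grid_max r b)}) : seq (position R n) :=
  let t := (last (origin R n) h).2 in
  rcons h (\row_i (sigma h ord0 i +
    (((c i).*2.+1)%:R / dilation r b i - 1) / dilation r (t + a) i), t + a + b).

Lemma grid_sizeP (R : realType) (n : nat) (r : 'rV[R]_n) (b : R) (i : 'I_n) :
  (grid_size r b i)%:R <= dilation r b i.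
Proof. by rewrite truncn_le// ltW// dilation_gt0. Qed.

Lemma sum_grid_prod (R : realType) (n : nat) (r : 'rV[R]_n) (b : R)
    (F : 'I_n -> nat -> R) :
  \sum_(c | grid r b c) \prod_i F i (c i) =
  \prod_i \sum_(0 <= j < grid_size r b i) F i j.
Proof.
rewrite -(bigA_distr_big_dep _ (fun i (j : 'I_(grid_max r b)) => F i j)).
apply: eq_bigr => i _.
rewrite big_mkord (big_ord_widen _ _ (leq_bigmax (F := grid_size r b) i)).
exact: eq_bigl.
Qed.

Lemma card_grid (R : realType) (n : nat) (r : 'rV[R]_n) (b : R) :
  #|grid r b|%:R = \prod_i (grid_size r b i)%:R :> R.
Proof.
rewrite -sumr_const.
rewrite (eq_bigr (fun c : {ffun 'I_n -> 'I_(grid_max r b)} => \prod_(i < n) (1 : R))).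
  rewrite (sum_grid_prod r b (fun _ _ => 1)); apply: eq_bigr => i _.
  by rewrite sumr_const_nat subn0.
by move=> c _; rewrite big1.
Qed.

Lemma grid_move_legal (R : realType) (n : nat) (r : 'rV[R]_n) (a b : R)
    (sigma : strategy R n) (h : seq (position R n)) c : grid r b c ->
  pos_le (Phi r) (@cube R n) (last (origin R n) (grid_move a sigma h c))
    (sigma h, (last (origin R n) h).2 + a).
Proof.
move=> /familyP gc y; rewrite /grid_move last_rcons; set t := (last _ h).2.
rewrite !psi_cubeP /= => yc i; have := yc i; rewrite mxE (dilationD r (t + a) b).
set Da := dilation r (t + a) i; set Db := dilation r b i => {}yc.
have Da0 : 0 < Da by exact: dilation_gt0.
have Db0 : 0 < Db by exact: dilation_gt0.
have cb : (c i)%:R + 1 <= Db.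
  by rewrite natr1; apply: le_trans (grid_sizeP r b i); rewrite ler_nat; exact: gc.
set s := sigma h ord0 i in yc *.
set x := (c i)%:R in cb.
have x0 : 0 <= x by rewrite ler0n.
have cE : ((c i).*2.+1)%:R = 2 * x + 1 :> R.
  by rewrite -natr1 -muln2 natrM mulrC.
move: yc; rewrite cE.
have -> : ((2 * x + 1) / Db - 1) / Da = (2 * x + 1) / (Da * Db) - Da^-1.
  by field; rewrite !gt_eqF.
have xD : (x + 1) / (Da * Db) <= Da^-1.
  by rewrite invfM mulrCA ler_piMr ?invr_ge0 ?(ltW Da0)// ler_pdivrMr// mul1r.
have xD0 : 0 <= x / (Da * Db) by rewrite divr_ge0// mulr_ge0// ltW.
have DD0 : 0 < (Da * Db)^-1 by rewrite invr_gt0 mulr_gt0.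
move: xD; rewrite !mulrDl !mul1r.
move: xD0; set A := x / _; set B := (Da * Db)^-1; set C := Da^-1.
rewrite !ler_norml => *; apply/andP; split; lra.
Qed.

Definition clamp (R : realType) (p q y : R) : R := Num.max p (Num.min y q).

Lemma clamp_homo (R : realType) (p q : R) : {homo clamp p q : x y / x <= y}.
Proof.
move=> x y xy; rewrite /clamp ge_max le_max lexx/= le_max.
by rewrite (le_min (Num.min _ _)) !ge_min xy lexx orbT/= orbT.
Qed.

(** Counting boxes by their volume: if the boxes of time [tf] that satisfy [P]
    are contained in the box with sides [p i, q i], their total volume is at
    most the volume of the part of that box inside the box of [h], a product
    of differences of clamped endpoints.  In the induction the grid cells are
    adjacent along each axis, so the sum over the children factors
    into one telescoping sum per axis. *)
Lemma density_volume (R : realType) (n : nat) (r : 'rV[R]_n) (a b : R)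
    (sigma : strategy R n) (P : pred (seq (position R n)))
    (p q : 'I_n -> R) (tf : R) (m : nat) (h : seq (position R n)) :
  (0 < #|grid r b|)%N ->
  (forall h, pos_le (Phi r) (@cube R n)
    (sigma h, (last (origin R n) h).2 + a) (last (origin R n) h)) ->
  (forall h, (last (origin R n) h).2 = tf -> P h -> forall i,
    p i <= (last (origin R n) h).1 ord0 i - (dilation r tf i)^-1 /\
    (last (origin R n) h).1 ord0 i + (dilation r tf i)^-1 <= q i) ->
  (last (origin R n) h).2 + m%:R * (a + b) = tf ->
  density R (grid r b) (grid_move a sigma) P m h *
    (#|grid r b|%:R ^+ m * \prod_i (2 / dilation r tf i)) <=
  \prod_i
   (clamp (p i) (q i) ((last (origin R n) h).1 ord0 i +
                       (dilation r (last (origin R n) h).2 i)^-1) -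
    clamp (p i) (q i) ((last (origin R n) h).1 ord0 i -
                       (dilation r (last (origin R n) h).2 i)^-1)).
Proof.
move=> N0 legal PE; elim: m h => [|m IH] h.
  rewrite mul0r addr0 expr0 mul1r /= => tE; rewrite tE.
  have [Ph|_] := boolP (P h); last first.
    rewrite mul0r; apply: prodr_ge0 => i _; rewrite subr_ge0 clamp_homo//.
    have := dilation_gt0 r tf i; rewrite -invr_gt0; lra.
  rewrite mul1r; apply: ler_prod => i _.
  have := dilation_gt0 r tf i; rewrite -invr_gt0 => D0.
  have [pl hq] := PE h tE Ph i.
  set x := (last _ h).1 ord0 i in pl hq *.
  set D := (dilation r tf i)^-1 in D0 pl hq *.
  have clampE y : p i <= y -> y <= q i -> clamp (p i) (q i) y = y.
    by move=> py yq; rewrite /clamp (min_idPl yq) (max_idPr py).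
  by rewrite !clampE; [apply/andP; split; lra|lra..].
move=> tE /=.
set t := (last (origin R n) h).2 in tE *; set x := (last (origin R n) h).1.
have N0' : #|grid r b|%:R != 0 :> R by rewrite pnatr_eq0 -lt0n.
(* Passing to the children cancels one factor [N]; the volumes do not change. *)
have shuffle (S V : R) : S / #|grid r b|%:R * (#|grid r b|%:R ^+ m.+1 * V) =
    S * (#|grid r b|%:R ^+ m * V) by rewrite exprS; field.
rewrite shuffle mulr_suml.
(* Alice's interval starts at [u i] and the grid has mesh [d i]. *)
pose u i := sigma h ord0 i - (dilation r (t + a) i)^-1.
pose d i := 2 / dilation r (t + a + b) i.
pose cl i := clamp (p i) (q i).
pose F i j := cl i (u i + j.+1%:R * d i) - cl i (u i + j%:R * d i).
apply: (@le_trans _ _ (\sum_(c | grid r b c) \prod_i F i (c i))).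
  apply: ler_sum => c gc.
  have tc : (last (origin R n) (grid_move a sigma h c)).2 = t + a + b.
    by rewrite /grid_move last_rcons.
  apply: le_trans (IH _ _) _.
    by rewrite tc -tE -natr1; ring.
  rewrite tc; apply: ler_prod => i _.
  rewrite /grid_move last_rcons /= mxE -/t.
  have D1 := dilation_gt0 r (t + a) i; have D2 := dilation_gt0 r b i.
  have -> : sigma h ord0 i + (((c i).*2.+1)%:R / dilation r b i - 1) /
      dilation r (t + a) i + (dilation r (t + a + b) i)^-1 =
      u i + (c i).+1%:R * d i.
    rewrite /u /d (dilationD r (t + a) b) -!natr1 -muln2 natrM.
    by field; rewrite !gt_eqF.
  have -> : sigma h ord0 i + (((c i).*2.+1)%:R / dilation r b i - 1) /
      dilation r (t + a) i - (dilation r (t + a + b) i)^-1 =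
      u i + (c i)%:R * d i.
    rewrite /u /d (dilationD r (t + a) b) -!natr1 -muln2 natrM.
    by field; rewrite !gt_eqF.
  rewrite lexx andbT subr_ge0 clamp_homo// lerD2l ler_wpM2r ?ler_nat//.
  by rewrite divr_ge0// ltW// dilation_gt0.
rewrite sum_grid_prod; apply: ler_prod => i _.
rewrite telescope_sumr// mul0r addr0.
have D1 := dilation_gt0 r (t + a) i; have D2 := dilation_gt0 r b i.
have d0 : 0 <= d i by rewrite divr_ge0// ltW// dilation_gt0.
have gd0 : 0 <= (grid_size r b i)%:R * d i by exact: mulr_ge0.
rewrite subr_ge0 clamp_homo ?lerDl//=.
have [lo hi] := pos_le_cube i (legal h).
rewrite lerB// clamp_homo//.
apply: le_trans hi; rewrite /u /d (dilationD r (t + a) b) /=.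
have : (grid_size r b i)%:R * (2 / (dilation r (t + a) i * dilation r b i)) <=
    2 * (dilation r (t + a) i)^-1.
  rewrite invfM mulrCA ler_pM2l// mulrCA ler_piMr ?invr_ge0 ?(ltW D1)//.
  by rewrite ler_pdivrMr// mul1r grid_sizeP.
lra.
Qed.

Lemma card_grid_ge (R : realType) (n : nat) (r : 'rV[R]_n) (b : R) :
  (forall i, 0 <= r ord0 i) -> \sum_(i < n) r ord0 i = 1 -> 0 <= b ->
  expR b ^+ n.+1 / 2 ^+ n <= #|grid r b|%:R.
Proof.
move=> hr hsum b0; rewrite -(prod_dilation b hsum) card_grid.
rewrite -[X in _ ^+ X](card_ord n) -prodr_const -prodf_div.
apply: ler_prod => i _; rewrite divr_ge0 ?(ltW (dilation_gt0 _ _ _))//=.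
have D1 : 1 <= dilation r b i.
  by apply: le_trans (dilation_ge (hr i) b0); rewrite -expR0 ler_expR.
have : dilation r b i < (grid_size r b i).+1%:R by rewrite truncnS_gt.
have : 1 <= (grid_size r b i)%:R :> R by rewrite ler1n truncn_gt0.
by rewrite -natr1; lra.
Qed.

(** * Winning sets are thick *)

Definition box_meets (R : realType) (n : nat) (r : 'rV[R]_n)
    (E : set 'rV[R]_n) : pred (seq (position R n)) :=
  fun h => `[< exists2 y, psi (Phi r) (@cube R n) (last (origin R n) h) y & E y >].

(** Boxes of stage [k] have sides at most [2 * expR (- u)], so those that meet
    [E] lie in a cube of side [6 * expR (- u)].  Dividing the volume of
    this cube by [N ^ k] times the volume of a box gives the bound: per
    stage, the product of [N] and of the volume ratio of the boxes is at least
    the inverse of [2 ^+ n * expR a ^+ n.+1], where [2 ^+ n] comes from rounding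
    the grid sizes and [expR a ^+ n.+1] from the part of the box that Alice
    gives up. *)
Lemma density_root_le (R : realType) (n : nat) (r : 'rV[R]_n) (a b u : R)
    (sigma : strategy R n) (x0 e : 'rV[R]_n) (t0 : R) (E : set 'rV[R]_n)
    (k : nat) :
  (forall i, 0 <= r ord0 i) -> \sum_(i < n) r ord0 i = 1 ->
  0 <= a -> 0 <= b -> 0 <= t0 -> u <= k%:R * b ->
  (forall h, pos_le (Phi r) (@cube R n)
    (sigma h, (last (origin R n) h).2 + a) (last (origin R n) h)) ->
  (forall y, E y -> forall i, `|y ord0 i - e ord0 i| <= expR (- u)) ->
  density R (grid r b) (grid_move a sigma) (box_meets r E) k [:: (x0, t0)] <=
  3 ^+ n * expR t0 ^+ n.+1 * (2 ^+ n * expR a ^+ n.+1) ^+ k * expR (- u) ^+ n.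
Proof.
move=> hr hsum a0 b0 t00 ukb legal Ee.
have N_ge := card_grid_ge hr hsum b0.
have B0 : 0 < expR b ^+ n.+1 / 2 ^+ n by rewrite divr_gt0 ?exprn_gt0 ?expR_gt0.
have N0' : 0 < #|grid r b|%:R :> R by apply: lt_le_trans N_ge.
have N0 : (0 < #|grid r b|)%N by rewrite -(ltr0n R).
pose tf := t0 + k%:R * (a + b).
pose eps := expR (- u).
have eps0 : 0 < eps by exact: expR_gt0.
have tf0 : 0 <= tf by rewrite addr_ge0// mulr_ge0 ?ler0n// addr_ge0.
have Deps i : (dilation r tf i)^-1 <= eps.
  rewrite /eps expRN lef_pV2 ?posrE ?expR_gt0 ?dilation_gt0//.
  apply: le_trans (dilation_ge (hr i) tf0); rewrite ler_expR.
  by apply: (le_trans ukb); rewrite /tf mulrDr addrA lerDr addr_ge0// mulr_ge0.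
pose p i := e ord0 i - eps - 2 * (dilation r tf i)^-1.
pose q i := e ord0 i + eps + 2 * (dilation r tf i)^-1.
have D0 i : 0 < (dilation r tf i)^-1 by rewrite invr_gt0 dilation_gt0.
have vol := @density_volume R n r a b sigma (box_meets r E) p q tf k
  [:: (x0, t0)] N0 legal.
have {}vol := vol _ erefl.
set dens := density _ _ _ _ _ _ in vol *.
have {vol} : dens * (#|grid r b|%:R ^+ k * \prod_i (2 / dilation r tf i)) <=
    (6 * eps) ^+ n.
  apply: le_trans (vol _) _.
    move=> h hE /asboolP[y /psi_cubeP yh Ey] i; rewrite hE in yh.
    have := yh i; have := Ee y Ey i; rewrite -/eps !ler_norml /p /q.
    by move=> /andP[? ?] /andP[? ?]; split; lra.
  rewrite -[X in _ <= _ ^+ X](card_ord n) -prodr_const.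
  apply: ler_prod => i _; rewrite subr_ge0 clamp_homo/=; last first.
    have := dilation_gt0 r t0 i; rewrite -invr_gt0; lra.
  have pq : p i <= q i by rewrite /p /q; have := D0 i; lra.
  have clamp_le y : p i <= clamp (p i) (q i) y <= q i.
    by rewrite /clamp le_max lexx/= ge_max pq ge_min lexx orbT.
  set c1 := clamp _ _ _; set c2 := clamp _ _ _.
  have := clamp_le (x0 ord0 i + (dilation r t0 i)^-1).
  have := clamp_le (x0 ord0 i - (dilation r t0 i)^-1).
  rewrite -/c1 -/c2 /p /q => /andP[? ?] /andP[? ?].
  by have := Deps i; have := D0 i; lra.
have -> : \prod_i (2 / dilation r tf i) = 2 ^+ n / expR tf ^+ n.+1.
  rewrite -(prod_dilation tf hsum) -[X in 2 ^+ X](card_ord n) -prodr_const.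
  by rewrite prodf_div.
rewrite -ler_pdivlMr; last first.
  by rewrite mulr_gt0 ?exprn_gt0// divr_gt0// exprn_gt0// expR_gt0.
move=> /le_trans; apply.
have -> : expR tf ^+ n.+1 = expR t0 ^+ n.+1 * (expR a ^+ n.+1) ^+ k *
    (expR b ^+ n.+1) ^+ k.
  rewrite -!exprM ![(n.+1 * k)%N]mulnC !exprM -!exprMn; congr (_ ^+ _).
  by rewrite /tf mulrDr expRD expRD !expRM_natl mulrA.
have T0 : 0 < expR t0 ^+ n.+1 by rewrite exprn_gt0 ?expR_gt0.
have A0 : 0 < expR a ^+ n.+1 by rewrite exprn_gt0 ?expR_gt0.
have BN : (expR b ^+ n.+1) ^+ k <= (2 ^+ n) ^+ k * #|grid r b|%:R ^+ k.
  rewrite -exprMn lerXn2r ?nnegrE ?exprn_ge0 ?expR_ge0 ?mulr_ge0 ?ler0n//.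
  by rewrite mulrC -ler_pdivrMr ?exprn_gt0.
have Nk0 : 0 < #|grid r b|%:R ^+ k :> R by rewrite exprn_gt0.
rewrite -/eps (_ : 6 = 3 * 2 :> R); last by rewrite -natrM.
rewrite ler_pdivrMr; last first.
  by rewrite mulr_gt0// divr_gt0 ?exprn_gt0// ?mulr_gt0// ?exprn_gt0// expR_gt0.
rewrite !exprMn.
move: T0 A0 BN Nk0.
set T := expR t0 ^+ _; set A := (expR a ^+ _); set B := (expR b ^+ _) ^+ k.
set N := #|grid r b|%:R ^+ k; set w := (2 ^+ n) ^+ k => T0 A0 BN Nk0.
have Ak0 : 0 < A ^+ k by rewrite exprn_gt0.
have Bk0 : 0 < B by rewrite !exprn_gt0 ?expR_gt0.
have -> : 3 ^+ n * T * (w * A ^+ k) * eps ^+ n * (N * (2 ^+ n / (T * A ^+ k * B)))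
  = 3 ^+ n * 2 ^+ n * eps ^+ n * (w * N / B) by field; rewrite !gt_eqF.
rewrite ler_peMr ?mulr_ge0 ?exprn_ge0 ?(ltW eps0)//.
by rewrite ler_pdivlMr// mul1r.
Qed.

(** A set of diameter [d > 0] has the scale [u = - ln d].  A set of diameter 0
    has none of its own: for [s > 0] it is given one so large that it costs at
    most [eta]. *)
Lemma gauge_radius (R : realType) (d s eta : R) :
  0 <= d <= 1 -> 0 <= s -> 0 < eta ->
  exists u, [/\ 0 <= u, d <= expR (- u) & expR (- (u * s)) <= d `^ s + eta].
Proof.
move=> /andP[d0 d1] s0 eta0.
have [dE|dn0] := eqVneq d 0; last first.
  have dgt0 : 0 < d by rewrite lt_neqAle eq_sym dn0.
  exists (- ln d); rewrite oppr_ge0 ln_le0// opprK lnK//; split => //.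
  by rewrite mulNr opprK /powR (negbTE dn0) mulrC lerDl ltW.
have [->|sn0] := eqVneq s 0.
  by exists 0; rewrite powRr0 mulr0 oppr0 expR0 lexx d1 lerDl (ltW eta0).
have sgt0 : 0 < s by rewrite lt_neqAle eq_sym sn0.
exists (Num.max 0 (- ln eta / s)); split; rewrite ?le_max ?lexx//.
  by rewrite dE expR_ge0.
apply: (@le_trans _ _ eta); last by rewrite lerDr powR_ge0.
rewrite -[leRHS]lnK ?posrE// ler_expR lerNl -ler_pdivrMr//.
by rewrite le_max lexx orbT.
Qed.

(** With [K] the loss per stage of [density_root_le], [b] is chosen so that
    [K <= expR (b * (n - s))].  At the first stage [k] with [u <= k * b],
    the density of a set of size [expR (- u)] is then at most
    [C * expR (- u * s)], that is, [C] times its contribution to the Hausdorff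
    sum.  A cover with sum below [(2 * C)^-1], each term being
    increased by a summable error, has total density below 1. *)
Lemma winning_hausdorff_measure_neq0 (R : realType) (n : nat) (r : 'rV[R]_n)
    (S U : set 'rV[R]_n) (s : R) :
  (0 < n)%N -> (forall i, 0 < r ord0 i) -> \sum_(i < n) r ord0 i = 1 ->
  winning (Phi r) (@cube R n) 0 S -> open U -> U !=set0 -> 0 <= s < n%:R ->
  hausdorff_measure s (S `&` U) <> 0%E.
Proof.
move=> hn hr hsum [a a0 win] Uo [z Uz] /andP[s0 sn] H0.
have hr0 i : 0 <= r ord0 i by exact: ltW.
have ns0 : 0 < n%:R - s by rewrite subr_gt0.
pose K : R := 2 ^+ n * expR a ^+ n.+1.
have K0 : 0 < K by rewrite mulr_gt0 ?exprn_gt0 ?expR_gt0.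
pose b : R := Num.max 1 (ln K / (n%:R - s)).
have b0 : 0 < b by rewrite lt_max ltr01.
have Kb : K <= expR (b * (n%:R - s)).
  by rewrite -[leLHS](lnK K0) ler_expR -ler_pdivrMr// le_max lexx orbT.
have [e /andP[e0 e1] eU] := nbhs_rV_box (open_nbhs_nbhs (conj Uo Uz)).
pose t0 := 1 - ln e.
have t00 : 0 <= t0 by have := ln_le0 e1; rewrite /t0; lra.
have w0U : psi (Phi r) (@cube R n) (z, t0) `<=` U.
  move=> y /psi_cubeP yz; apply: eU => i; apply: le_lt_trans (yz i) _.
  rewrite -[ltRHS]lnK ?posrE// -[ln e]opprK expRN.
  rewrite ltf_pV2 ?posrE ?expR_gt0 ?dilation_gt0//.
  apply: lt_le_trans (dilation_ge (hr0 i) t00).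
  by rewrite ltr_expR /t0 ltrDr ltr01.
have [sigma [legal sigma_win]] :=
  always_legal_strategy (origin R n) (is_astar_cube hr0) a0 (win b b0).
pose dens P k := density R (grid r b) (grid_move a sigma) P k [:: (z, t0)].
pose C : R := 3 ^+ n * expR t0 ^+ n.+1 * expR (b * (n%:R - s)).
have C0 : 0 < C by rewrite !mulr_gt0 ?exprn_gt0 ?expR_gt0.
have dens_small (E : set 'rV[R]_n) (x : 'rV[R]_n) u : 0 <= u ->
    (forall y, E y -> forall i, `|y ord0 i - x ord0 i| <= expR (- u)) ->
    exists k, dens (box_meets r E) k <= C * expR (- (u * s)).
  move=> u0 Ex; pose k := (Num.truncn (u / b)).+1; exists k.
  have uk : u <= k%:R * b by rewrite -ler_pdivrMr// ltW// truncnS_gt.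
  have ku : k%:R * b <= u + b.
    rewrite -ler_pdivlMr// mulrDl divff ?gt_eqF// -natr1 lerD2r.
    by rewrite truncn_le// divr_ge0// ltW.
  apply: le_trans (density_root_le z hr0 hsum (ltW a0) (ltW b0) t00 uk legal Ex) _.
  rewrite /C -!mulrA ler_pM2l ?exprn_gt0// ler_pM2l ?exprn_gt0 ?expR_gt0//.
  rewrite -/K.
  apply: (@le_trans _ _ (expR ((u + b) * (n%:R - s)) * expR (- u) ^+ n)).
    rewrite ler_pM2r ?exprn_gt0 ?expR_gt0//.
    apply: (@le_trans _ _ (expR (b * (n%:R - s)) ^+ k)).
      by rewrite lerXn2r ?nnegrE ?expR_ge0 ?(ltW K0).
    by rewrite -expRM_natl ler_expR mulrA ler_pM2r.
  rewrite -expRM_natl -!expRD ler_expR.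
  by rewrite le_eqVlt; apply/orP; left; apply/eqP; ring.
pose eta := (2 * C)^-1.
have eta0 : 0 < eta by rewrite invr_gt0 mulr_gt0.
have [cov [SUcov covd covs]] :=
  (hausdorff_measure_eq0P s (S `&` U)).1 H0 1 eta ltr01 eta0.
have ex_k j : exists k, ((dens (box_meets r (cov j)) k)%:E <=
    C%:E * (hausdorff_gauge s (cov j) + (eta / (2 ^ j.+1)%:R)%:E))%E.
  have eta'0 : 0 < eta / (2 ^ j.+1)%:R by rewrite divr_gt0// ltr0n expn_gt0.
  have [cov0|/set0P[x xcov]] := eqVneq (cov j) set0.
    exists 0%N; rewrite /dens density_eq0; last first.
      by move=> h; apply/negP => /asboolP[y _]; rewrite cov0.
    rewrite mule_ge0 ?lee_fin ?(ltW C0)// adde_ge0 ?lee_fin ?(ltW eta'0)//.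
    exact: hausdorff_gauge_ge0.
  have cov0 : cov j !=set0 by exists x.
  have d0 := diameter_ge0 cov0; have d1 := covd j.
  have dfin : diameter (cov j) \is a fin_num.
    by rewrite ge0_fin_numE// (le_lt_trans d1)// ltry.
  have gE : hausdorff_gauge s (cov j) = ((fine (diameter (cov j))) `^ s)%:E.
    rewrite /hausdorff_gauge ifF; last exact/negbTE/set0P.
    by rewrite -poweR_EFin fineK.
  have d01 : 0 <= fine (diameter (cov j)) <= 1.
    by rewrite fine_ge0//= -lee_fin fineK.
  have [u [u0 du us]] := gauge_radius d01 s0 eta'0.
  have near y : cov j y -> forall i, `|y ord0 i - x ord0 i| <= expR (- u).
    move=> ycov i; apply: le_trans du; rewrite -lee_fin fineK//.
    apply: (@le_trans _ _ `|y - x|%:E).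
      rewrite lee_fin.
      by have := (rV_normP (y - x) (normr_ge0 _)).1 (lexx _) i; rewrite !mxE.
    by apply: ereal_sup_ubound; exists (y, x).
  have [k hk] := dens_small _ _ _ u0 near; exists k.
  rewrite gE -EFinD -EFinM lee_fin (le_trans hk)//.
  by rewrite ler_pM2l.
have [k hk] := choice ex_k.
have N0 : (0 < #|grid r b|)%N.
  rewrite -(ltr0n R); apply: lt_le_trans (card_grid_ge hr0 hsum (ltW b0)).
  by rewrite divr_gt0 ?exprn_gt0 ?expR_gt0.
have Pup j h c : grid r b c ->
    box_meets r (cov j) (grid_move a sigma h c) -> box_meets r (cov j) h.
  move=> gc /asboolP[y yh yj]; apply/asboolP; exists y => //.
  exact/(legal h)/(grid_move_legal gc).
have sum_lt1 : (\sum_(0 <= j <oo) (dens (box_meets r (cov j)) (k j))%:E < 1)%E.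
  apply: (@le_lt_trans _ _ (C%:E * (\sum_(0 <= j <oo)
      (hausdorff_gauge s (cov j) + (eta / (2 ^ j.+1)%:R)%:E)))%E).
    rewrite -nneseriesZl//; last first.
      move=> j _; rewrite adde_ge0 ?hausdorff_gauge_ge0// lee_fin.
      by rewrite divr_ge0 ?ler0n// ltW.
    apply: lee_nneseries => [j _ _|j _]; last exact: hk.
    by rewrite lee_fin density_ge0.
  apply: (@le_lt_trans _ _ (C%:E * (\sum_(0 <= j <oo) hausdorff_gauge s (cov j)
      + eta%:E))%E).
    apply: lee_wpmul2l; first by rewrite lee_fin ltW.
    by apply: epsilon_trick; [move=> j; exact: hausdorff_gauge_ge0|exact: ltW].
  rewrite -[ltRHS](_ : C%:E * (eta%:E + eta%:E) = _)%E; last first.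
    rewrite -EFinD -EFinM; congr EFin.
    by rewrite /eta; field; rewrite gt_eqF.
  by rewrite lte_pmul2l ?lte_fin// lteD2rE.
have [v [v0 vstep vavoid]] := greedy_branch N0 Pup sum_lt1.
pose w i := last (origin R n) (v i).
have vE i : v i = mkseq w i.+1.
  elim: i => [|i IH]; first by rewrite v0 /mkseq /= /w v0.
  have [c _ vS] := vstep i.
  by rewrite mkseqS -IH /w vS /grid_move last_rcons.
have move_legal i : bob_legal (Phi r) (@cube R n) a b sigma w i.
  have [c gc vS] := vstep i; split.
    by rewrite /w vS /grid_move last_rcons.
  by rewrite /alice_move -vE /w vS; exact: grid_move_legal.
have nested i : pos_le (Phi r) (@cube R n) (w i.+1) (w i).
  apply: subset_trans (move_legal i).2 _.
  by rewrite /alice_move -vE; exact: legal.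
have [x xw] := psi_cube_nested nested.
have xS : S x by apply: (sigma_win w move_legal) => i _.
have xU : U x by apply: w0U; have := xw 0%N; rewrite /w v0.
have [j _ xj] := SUcov x (conj xS xU).
by have /negP := vavoid j; apply; apply/asboolP; exists x => //; exact: xw.
Qed.

Lemma winning_thick (R : realType) (n : nat) (r : 'rV[R]_n) (S : set 'rV[R]_n) :
  (0 < n)%N -> (forall i, 0 < r ord0 i) -> \sum_(i < n) r ord0 i = 1 ->
  winning (Phi r) (@cube R n) 0 S -> thick S.
Proof.
move=> hn hr hsum win U Uo U0; apply/eqP; rewrite eq_le; apply/andP; split.
  apply/lee_addgt0Pr => e e0; apply: ereal_inf_lbound; exists (n%:R + e) => //=.
  split; first by rewrite addr_ge0 ?ler0n// ltW.
  by apply: hausdorff_measure_gt_dim; rewrite ltrDl.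
apply: le_ereal_inf_tmp => _ [s [s0 Hs] <-]; rewrite lee_fin leNgt.
apply/negP => sn.
by apply: (winning_hausdorff_measure_neq0 hn hr hsum win Uo U0 _ Hs); rewrite s0.
Qed.

Unset Implicit Arguments.

Theorem theorem1p1 (R : realType) (n : nat) (hn : (1 <= n)%N) (r : 'rV[R]_n)
    (hr : forall i : 'I_n, 0 < r ord0 i)
    (hsum : \sum_(i < n) r ord0 i = 1) :
  (forall (D0 : set 'rV[R]_n) (astar : R), admissible D0 ->
     is_astar (Phi r) D0 astar ->
     winning (Phi r) D0 astar (Bad r)) /\
  thick (Bad r).
Proof.
split=> [D0 astar hD0 [astar0 _]|]; first exact: Bad_winning.
apply: (winning_thick hn hr hsum).
exact: (Bad_winning hn hr hsum (admissible_cube _ _) (lexx 0)).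
Qed.
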